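(* Let $G,H$ be locally compact second countable groups and let $G\curvearrowright(X,\mu)$ be a non-singular action. Suppose that $\omega:G\times X\to H$ is a proper cocycle with respect to some family $\mathcal{A}$ of Borel subsets of $X$, and that the pair $(G,X)$ has property A with respect to the same family $\mathcal{A}$. If $H$ has property A (respectively, is coarsely embeddable), then $G$ has property A (respectively, is coarsely embeddable).
   Context: **Actions and cocycles.** A non-singular action $G\curvearrowright(X,\mu)$ is a Borel action of a locally compact second countable (l.c.s.c.) group on a standard probability space preserving the class of null sets. A cocycle is a Borel map $\omega:G\times X\to H$ into an l.c.s.c. group $H$ such that for all $g,h\in G$, $\omega(gh,x)=\omega(g,hx)\omega(h,x)$ for almost every $x\in X$. **Proper cocycle with respect to a family.** A cocycle $\omega:G\times X\to H$ is proper with respect to a family $\mathcal{A}$ of Borel sets in $X$ if (1) for every compact $K\subset G$ and all $A,B\in\mathcal{A}$ there is a precompact set $L(K,A,B)\subset H$ such that for every $g\in K$, $\omega(g,x)\in L(K,A,B)$ for almost all $x\in A\cap g^{-1}B$; and (2) for every compact $L\subset H$ and all $A,B\in\mathcal{A}$, the set of all $g\in G$ such that $\mu\{x\in X\mid x\in A,\ gx\in B,\ \omega(g,x)\in L\}>0$ is precompact in $G$. **Property A for pairs.** The pair $(G,X)$ has property A with respect to a family $\mathcal{A}$ of Borel subsets of $X$ if for every compact $K\subset G$ and every $\varepsilon>0$ there is a continuous family $(\xi_g)_{g\in G}$ of unit vectors in $L^2(X,\mu)$ such that $\|\xi_g-\xi_h\|_2<\varepsilon$ whenever $g^{-1}h\in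 K$, and there is a set $A\in\mathcal{A}$ such that each $\xi_g$ is supported in $gA$. **Property A for groups.** An l.c.s.c. group $G$ with left Haar measure $\mu_G$ has property A if for every compact $K\subset G$ and every $\varepsilon>0$ there is a continuous family $(\xi_g)_{g\in G}$ of unit vectors in $L^2(G,\mu_G)$ such that $\|\xi_g-\xi_h\|<\varepsilon$ whenever $g^{-1}h\in K$, and there is a compact set $L\subset G$ such that each $\xi_g$ is supported in $gL$. Equivalently (known): for every compact $K\subset G$ and $\varepsilon>0$ there is a continuous positive definite kernel $k:G\times G\to\mathbb{C}$ with $|k(g,h)-1|<\varepsilon$ whenever $g^{-1}h\in K$ and with $\{g^{-1}h\mid k(g,h)\neq 0\}$ precompact. **Coarse embeddability.** $G$ is coarsely embeddable (into Hilbert space) if there are a Hilbert space $\mathcal{H}$ and a continuous map $u:G\to\mathcal{H}$ such that (i) for every compact $K\subset G$ there is $R>0$ with $\|u(g)-u(h)\|<R$ for all $g,h\in G$ with $g^{-1}h\in K$; and (ii) for every $R>0$ the set $\{g^{-1}h\in G\mid \|u(g)-u(h)\|<R\}$ is precompact. *)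

(* Defs.v *)
From HB Require Import structures.
From mathcomp Require Import all_boot all_order all_algebra.
From mathcomp Require Import complex.
From mathcomp Require Import all_classical all_reals all_analysis.

Set Implicit Arguments.
Unset Strict Implicit.
Unset Printing Implicit Defensive.

Import Order.TTheory GRing.Theory Num.Theory.
Import numFieldNormedType.Exports.

Local Open Scope classical_set_scope.
Local Open Scope ring_scope.

(* The distinguished point is unrelated to the group law; it is there because
   [measurableType] inherits from [pointedType]. *)
HB.mixin Record isTopologicalGroup G of Group G & PointedTopological G := {
  mulg_continuous : continuous (fun p : G * G => (p.1 * p.2)%g);
  invg_continuous : continuous (fun g : G => (g^-1)%g)
}.

#[short(type="topologicalGroupType")]
HB.structure Definition TopologicalGroup :=
  {G of isTopologicalGroup G & Group G & PointedTopological G}.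

(* Locally compact groups are Hausdorff by convention. *)
Definition lcsc (G : topologicalGroupType) : Prop :=
  [/\ hausdorff_space G, locally_compact [set: G] & @second_countable G].

Notation borel G := (g_sigma_algebraType (@open G)).

(* In a second countable locally compact group, regularity of a Borel measure
   that is finite on compact sets is automatic. *)
Definition left_haar (R : realType) (G : topologicalGroupType)
    (mu : {measure set (borel G) -> \bar R}) : Prop :=
  [/\ forall (g : G) (A : set (borel G)), measurable A ->
        mu [set (g * a)%g | a in A] = mu A,
      forall K : set G, compact K -> (mu K < +oo)%E
    & (0 < mu [set: G])%E].

(* X is Borel isomorphic to a Polish space. *)
Definition standard_borel (R : realType) d (X : measurableType d) : Prop :=
  exists (T : completePseudoMetricType R) (f : X -> T),
    [/\ hausdorff_space T, @second_countable T, bijective f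
      & forall A : set X, measurable A <-> <<s @open T >> (f @` A)].

Record nonsingular_action (R : realType) (G : topologicalGroupType) d
    (X : measurableType d) (mu : {measure set X -> \bar R})
    (act : G -> X -> X) : Prop := {
  action1 : forall x, act 1%g x = x;
  actionM : forall g h x, act (g * h)%g x = act g (act h x);
  action_measurable :
    measurable_fun [set: borel G * X] (fun p : borel G * X => act p.1 p.2);
  action_null : forall g (A : set X), measurable A ->
    mu (act g @^-1` A) = 0%E <-> mu A = 0%E
}.

Record is_cocycle (R : realType) (G H : topologicalGroupType) d
    (X : measurableType d) (mu : {measure set X -> \bar R})
    (act : G -> X -> X) (omega : G -> X -> H) : Prop := {
  cocycle_measurable :
    measurable_fun [set: borel G * X]
      (fun p : borel G * X => omega p.1 p.2 : borel H);
  cocycleM : forall g h : G,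
    {ae mu, forall x, omega (g * h)%g x = (omega g (act h x) * omega h x)%g}
}.

Record proper_cocycle (R : realType) (G H : topologicalGroupType) d
    (X : measurableType d) (mu : {measure set X -> \bar R})
    (act : G -> X -> X) (omega : G -> X -> H) (F : set (set X)) : Prop := {
  proper_bounded : forall (K : set G) (A B : set X),
    compact K -> F A -> F B ->
    exists2 L : set H, precompact L &
      forall g, K g -> {ae mu, forall x, A x -> B (act g x) -> L (omega g x)};
  proper_return : forall (L : set H) (A B : set X),
    compact L -> F A -> F B ->
    precompact [set g : G |
      (0 < mu [set x | [/\ A x, B (act g x) & L (omega g x)]])%E]
}.

(* Vectors of the complex Hilbert space L^2(X, mu) are represented by
   measurable functions; all notions below are invariant under almost
   everywhere equality. *)
Definition cmeasurable (R : realType) d (X : measurableType d)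
    (f : X -> R[i]) : Prop :=
  measurable_fun [set: X] (fun x => complex.Re (f x)) /\
  measurable_fun [set: X] (fun x => complex.Im (f x)).

Definition L2norm (R : realType) d (X : measurableType d)
    (mu : {measure set X -> \bar R}) (f : X -> R[i]) : \bar R :=
  ('N[mu]_2%:E [EFin \o (fun x => Normc.normc (f x))])%E.

Definition L2unit (R : realType) d (X : measurableType d)
    (mu : {measure set X -> \bar R}) (f : X -> R[i]) : Prop :=
  cmeasurable f /\ L2norm mu f = 1%:E.

Definition L2continuous (R : realType) (G : topologicalType) d
    (X : measurableType d) (mu : {measure set X -> \bar R})
    (xi : G -> X -> R[i]) : Prop :=
  forall (g : G) (e : R), 0 < e ->
    \forall h \near g, (L2norm mu (xi h \- xi g)%R < e%:E)%E.

Definition ae_supported (R : realType) d (X : measurableType d)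
    (mu : {measure set X -> \bar R}) (f : X -> R[i]) (A : set X) : Prop :=
  {ae mu, forall x, ~ A x -> f x = 0}.

Definition pair_property_A (R : realType) (G : topologicalGroupType) d
    (X : measurableType d) (mu : {measure set X -> \bar R})
    (act : G -> X -> X) (F : set (set X)) : Prop :=
  forall (K : set G) (e : R), compact K -> 0 < e ->
  exists xi : G -> X -> R[i],
    [/\ forall g, L2unit mu (xi g),
        L2continuous mu xi,
        forall g h, K (g^-1 * h)%g -> (L2norm mu (xi g \- xi h)%R < e%:E)%E
      & exists2 A : set X, F A & forall g, ae_supported mu (xi g) (act g @` A)].

(* Property A of G is property A of the pair (G, G), for left translations,
   left Haar measure and the family of compact sets. *)
Definition group_property_A (R : realType) (G : topologicalGroupType)
    (muG : {measure set (borel G) -> \bar R}) : Prop :=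
  pair_property_A muG (fun g x : G => (g * x)%g) [set L : set G | compact L].

(* V is a Hilbert space when its norm comes from an inner product. *)
Definition norm_of_dot (R : realType) (V : completeNormedModType R[i])
    (dot : {dot V for Num.conj}) : Prop :=
  forall v : V, `|v| ^+ 2 = dot v v.

(* Norms in V take values in R[i]; r%:C is the real number r seen in R[i]. *)
Definition coarsely_embeddable (R : realType) (G : topologicalGroupType)
    : Prop :=
  exists (V : completeNormedModType R[i]) (dot : {dot V for Num.conj})
      (u : G -> V),
    [/\ norm_of_dot dot,
        continuous u,
        forall K : set G, compact K -> exists2 r : R, 0 < r &
          forall g h, K (g^-1 * h)%g -> `|u g - u h| < (r%:C)%C
      & forall r : R, 0 < r -> precompact
          [set k : G | exists g h, k = (g^-1 * h)%g /\
                                   `|u g - u h| < (r%:C)%C]].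

(* Main.v *)
From HB Require Import structures.
Require Import Defs.
From mathcomp Require Import all_boot all_order all_algebra.
From mathcomp Require Import complex.
From mathcomp Require Import all_classical all_reals all_analysis.
From mathcomp Require Import measurable_realfun ring lra.

(** Why both properties pass from [H] to [G].

    Let [xi_g] be the unit vectors given by property A of the pair, supported in
    [gA].  Put [q_g = |xi_g|] and [s_g(x) = omega(g^-1, x)^-1].  The cocycle
    identity gives [s_g(x)^-1 s_h(x) = omega(g^-1 h, h^-1 x)], and this is read
    at a point of [A] that [g^-1 h] sends to a point of [A] as soon as [x] lies
    in [gA] and in [hA].  Properness therefore says that on the common support of
    [q_g] and [q_h] the positions [s_g(x)] and [s_h(x)] are at bounded distance
    when [g^-1 h] stays in a compact set, and leave every compact tube when
    [g^-1 h] does ([proper_cocycle_field]).  Data on [H], read at the positions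
    [s_g(x)] with weights [q_g(x)], are then averaged over [X].

    Coarse embeddability.  If [D] is the distance of [H] in its Hilbert space,
    [exp(-a D^2)] is positive semidefinite, hence so is the average
    [k(g, h) = int q_g q_h exp(-a D(s_g, s_h)^2)]; it is close to 1 on a given
    tube for small [a], and at most 1/2 off some tube ([positive_kernel]).
    Summing [1 - k_n] for kernels [k_n] that are better and better on an
    exhaustion of [G] gives a kernel of negative type that is bounded on tubes
    and proper ([negative_type_of_kernels]), that is, half the squared distance
    of a map into a Hilbert space.

    Property A.  Property A of [H] is turned into probability weights [b_s] on a
    sequence of points of [H] which vary slowly with [s] and live near [s]
    ([reiter_of_property_A]).  The densities [q_g(x)^2 b_(s_g(x))(j)] on
    [X * nat] have overlapping supports only for close [g] and [h].  Cutting
    [X * nat] along the supports attached to a suitable sequence [c_n] of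
    elements of [G] turns them into weights on the points [c_n] with the same
    properties for [G] ([exhaustion], [reiter_transfer]); spreading these over
    translates of a compact set and taking square roots gives vectors of [L^2(G)]
    ([property_A_of_reiter]).

    Neither construction is continuous in [g], since a cocycle is only
    measurable.  Continuity is restored at the end: values at the points [p_i] of
    a locally finite partition of unity subordinate to translates of a compact
    set are averaged with its weights.  Only points at bounded distance from [g]
    are averaged at [g], so all estimates survive with larger compact sets.  In
    the coarse case this has a further benefit: the Hilbert space only has to
    contain countably many points with prescribed distances, and these are
    produced in [l2] by the Cholesky algorithm ([negative_type_embedding]). *)

Set Implicit Arguments.
Unset Strict Implicit.
Unset Printing Implicit Defensive.

Import Order.TTheory GRing.Theory Num.Theory.
Import numFieldNormedType.Exports.

Local Open Scope classical_set_scope.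
Local Open Scope ring_scope.

(** * The Hilbert space of square-summable complex sequences *)

Section l2.
Variable R : realType.
Local Notation C := R[i].
Implicit Types (f g : nat -> C) (N : nat).

Definition l2_seminorm N f : R :=
  Num.sqrt (\sum_(i < N) Normc.normc (f i) ^+ 2).

Lemma l2_seminorm_ge0 N f : 0 <= l2_seminorm N f.
Proof. exact: sqrtr_ge0. Qed.

Lemma l2_seminorm_sqr N f :
  l2_seminorm N f ^+ 2 = \sum_(i < N) Normc.normc (f i) ^+ 2.
Proof. by rewrite sqr_sqrtr// sumr_ge0// => i _; rewrite sqr_ge0. Qed.

Lemma l2_seminormS N f :
  l2_seminorm N.+1 f = Normc.normc (l2_seminorm N f +i* Normc.normc (f N))%C.
Proof. by rewrite /Normc.normc l2_seminorm_sqr {1}/l2_seminorm big_ord_recr. Qed.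

Lemma normc_ge0 (z : C) : 0 <= Normc.normc z.
Proof. by case: z => a b; exact: sqrtr_ge0. Qed.

Lemma normc_mono (a b c d : R) : 0 <= a -> a <= c -> 0 <= b -> b <= d ->
  Normc.normc (a +i* b)%C <= Normc.normc (c +i* d)%C.
Proof.
move=> a0 ac b0 bd; rewrite /Normc.normc ler_wsqrtr// lerD//.
  by rewrite lerXn2r// nnegrE (le_trans a0).
by rewrite lerXn2r// nnegrE (le_trans b0).
Qed.

(** The step of the induction is the triangle inequality for the complex
    numbers whose two coordinates are the norm of the first [N] terms and the
    modulus of the next one. *)
Lemma l2_seminormD N f g :
  l2_seminorm N (f + g) <= l2_seminorm N f + l2_seminorm N g.
Proof.
elim: N => [|N IH]; first by rewrite /l2_seminorm !big_ord0 sqrtr0 addr0.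
rewrite !l2_seminormS; apply: le_trans (le_normcD _ _).
by apply: normc_mono; rewrite ?l2_seminorm_ge0 ?normc_ge0//
  le_normcD.
Qed.

Lemma l2_seminormZ N (a : C) f :
  l2_seminorm N (a *: f) = Normc.normc a * l2_seminorm N f.
Proof.
rewrite /l2_seminorm; under eq_bigr do
  rewrite [(a *: f) _]/= Normc.normcM exprMn.
by rewrite -mulr_sumr sqrtrM ?sqr_ge0// sqrtr_sqr ger0_norm// normc_ge0.
Qed.

Lemma l2_seminormN N f : l2_seminorm N (- f) = l2_seminorm N f.
Proof.
by rewrite /l2_seminorm; under eq_bigr do rewrite [(- f) _]/= normcN.
Qed.

Lemma l2_seminorm_le N M f : (N <= M)%N -> l2_seminorm N f <= l2_seminorm M f.
Proof.
move=> NM; rewrite ler_wsqrtr// -(subnKC NM) big_split_ord/= lerDl.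
by rewrite sumr_ge0// => i _; rewrite sqr_ge0.
Qed.

Lemma l2_seminorm_coord N f i : (i < N)%N ->
  Normc.normc (f i) <= l2_seminorm N f.
Proof.
move=> iN; apply: le_trans (l2_seminorm_le f iN).
by rewrite l2_seminormS -{1}(ger0_norm (normc_ge0 (f i))) -sqrtr_sqr ler_wsqrtr// lerDr sqr_ge0.
Qed.

Definition l2_pred : {pred (nat -> C)} :=
  fun f => `[< has_ubound (range (l2_seminorm ^~ f)) >].

Lemma l2_predP f :
  reflect (exists M, forall N, l2_seminorm N f <= M) (f \in l2_pred).
Proof.
apply: (iffP (asboolP _)) => -[M Mf]; exists M; first by move=> N; apply: Mf; exists N.
by move=> _ [N _ <-]; exact: Mf.
Qed.

Lemma l2_pred_submod : submod_closed l2_pred.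
Proof.
split=> [|a f g /l2_predP[M fM] /l2_predP[M' gM']]; apply/l2_predP.
  exists 0 => N; rewrite /l2_seminorm big1 ?sqrtr0// => i _.
  by rewrite /Normc.normc /= expr0n/= addr0 sqrtr0 expr0n.
exists (Normc.normc a * M + M') => N; apply: (le_trans (l2_seminormD _ _ _)).
by rewrite lerD// l2_seminormZ ler_wpM2l// normc_ge0.
Qed.
HB.instance Definition _ :=
  GRing.isSubmodClosed.Build C (nat -> C) l2_pred l2_pred_submod.

Record l2 := L2Seq { l2_val :> nat -> C; _ : l2_val \in l2_pred }.
HB.instance Definition _ := [isSub for l2_val].
HB.instance Definition _ := [Choice of l2 by <:].
HB.instance Definition _ := [SubChoice_isSubLmodule of l2 by <:].

Implicit Types u v w : l2.

Lemma l2D u v i : (u + v) i = u i + v i. Proof. by []. Qed.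
Lemma l2N u i : (- u) i = - u i. Proof. by []. Qed.
Lemma l2Z a u i : (a *: u) i = a * u i. Proof. by []. Qed.

Definition l2_norm u : R := limn (l2_seminorm ^~ u).

Lemma l2_seminorm_ubound u : has_ubound (range (l2_seminorm ^~ u)).
Proof. by case: u => f /= /asboolP. Qed.

Lemma l2_seminorm_nondec f : {homo l2_seminorm ^~ f : n m / (n <= m)%N >-> n <= m}.
Proof. by move=> n m; exact: l2_seminorm_le. Qed.

Lemma l2_seminorm_cvg u : l2_seminorm ^~ u @ \oo --> l2_norm u.
Proof. exact: (nondecreasing_is_cvgn (@l2_seminorm_nondec _) (l2_seminorm_ubound u)). Qed.

Lemma l2_seminorm_le_norm N u : l2_seminorm N u <= l2_norm u.
Proof.
apply: (@nondecreasing_cvgn_le _ (l2_seminorm ^~ u)).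
  exact: l2_seminorm_nondec.
exact: (l2_seminorm_cvg (u:=u)).
Qed.

Lemma l2_norm_le u M : (forall N, l2_seminorm N u <= M) -> l2_norm u <= M.
Proof.
by move=> uM; apply: limr_le; [exact: (l2_seminorm_cvg (u:=u))|exact: nearW].
Qed.

Lemma l2_norm_ge0 u : 0 <= l2_norm u.
Proof. exact: le_trans (l2_seminorm_ge0 0 u) (l2_seminorm_le_norm _ _). Qed.

Lemma l2_normD u v : l2_norm (u + v) <= l2_norm u + l2_norm v.
Proof.
apply: l2_norm_le => N; apply: (le_trans (l2_seminormD _ _ _)).
by rewrite lerD// l2_seminorm_le_norm.
Qed.

Lemma l2_normZ a u : l2_norm (a *: u) = Normc.normc a * l2_norm u.
Proof.
apply: (@cvg_lim R^o) => //; under eq_fun do rewrite [l2_val _]/= l2_seminormZ.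
by apply: cvgM; [exact: cvg_cst|exact: l2_seminorm_cvg].
Qed.

Definition l2_cnorm u : C := (l2_norm u)%:C%C.

Lemma l2_cnormD u v : l2_cnorm (u + v) <= l2_cnorm u + l2_cnorm v.
Proof. by rewrite /l2_cnorm -rmorphD/= lecR l2_normD. Qed.

Lemma l2_cnormZ a u : l2_cnorm (a *: u) = `|a| * l2_cnorm u.
Proof. by rewrite /l2_cnorm l2_normZ rmorphM. Qed.

Lemma l2_cnorm0_eq0 u : l2_cnorm u = 0 -> u = 0.
Proof.
move=> [u0]; apply: val_inj; apply/funext => i /=.
apply: Normc.eq0_normc; apply/eqP; rewrite eq_le normc_ge0 andbT -u0.
by apply: le_trans (l2_seminorm_le_norm i.+1 u); exact: l2_seminorm_coord.
Qed.

HB.instance Definition _ :=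
  Lmodule_isNormed.Build C l2 l2_cnormD l2_cnormZ l2_cnorm0_eq0.

Lemma l2_normE u : `|u| = (l2_norm u)%:C%C. Proof. by []. Qed.


Lemma l2_seminorm_coord0 N f (e : R) : 0 < e ->
  exists2 d : R, 0 < d & forall g,
    (forall i, (i < N)%N -> Normc.normc (f i - g i) < d) ->
    l2_seminorm N (f - g) < e.
Proof.
move=> e0; elim: N e e0 => [|N IH] e e0.
  by exists 1 => // g _; rewrite /l2_seminorm big_ord0 sqrtr0.
have [d d0 dP] := IH (e / 2) ltac:(by rewrite divr_gt0).
exists (Num.min d (e / 2)); first by rewrite lt_min d0 divr_gt0.
move=> g fg; rewrite l2_seminormS.
have -> : (l2_seminorm N (f - g) +i* Normc.normc ((f - g) N))%C =
    (l2_seminorm N (f - g) +i* 0)%C + (0 +i* Normc.normc ((f - g) N))%C :> C.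
  by apply/eqP; rewrite eq_complex/= addr0 add0r !eqxx.
apply: (le_lt_trans (le_normcD _ _)).
rewrite /= expr0n/= addr0 add0r !sqrtr_sqr.
rewrite !ger0_norm ?normc_ge0 ?l2_seminorm_ge0// (splitr e) ltrD//.
  by apply: dP => i iN; have := fg i (ltnW iN); rewrite lt_min => /andP[].
by have := fg N (ltnSn _); rewrite lt_min => /andP[].
Qed.

Lemma Re_normc_le (z : C) : `|complex.Re z| <= Normc.normc z.
Proof. by have := normc_ge_Re z; rewrite normc_def lecR; case: z. Qed.

Lemma Im_normc_le (z : C) : `|complex.Im z| <= Normc.normc z.
Proof.
case: z => a b /=; rewrite -sqrtr_sqr ler_wsqrtr// lerDr sqr_ge0 //.
Qed.

Lemma normc_le_ReIm (z : C) :
  Normc.normc z <= `|complex.Re z| + `|complex.Im z|.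
Proof.
case: z => a b /=; rewrite -[leRHS]ger0_norm ?addr_ge0// -sqrtr_sqr ler_wsqrtr//.
by rewrite sqrrD !real_normK ?num_real// lerD2r lerDl mulrn_wge0 // mulr_ge0.
Qed.

Lemma l2_norm_lt (u : l2) (e : R) : `|u| < e%:C%C -> l2_norm u < e.
Proof. by rewrite l2_normE ltcR. Qed.

Lemma l2_coord_cvg (F : set_system l2) (i : nat) : ProperFilter F -> cauchy F ->
  exists z : C, forall e : R, 0 < e ->
    \forall u \near F, Normc.normc ((u : l2) i - z) < e.
Proof.
move=> FF /cauchyP Fc.
have H (p : C -> R) : (forall a b, p (a - b) = p a - p b) ->
    (forall z, `|p z| <= Normc.normc z) ->
    cvg ((fun u : l2 => p (u i)) @ F).
  move=> pB ple; apply: R_complete.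

  apply/cauchyP => e e0.
  have [|u Fu] := Fc (e%:C)%C; first by rewrite ltcR.
  exists (p (u i)).
  suff : \forall v \near F, ball (p (u i)) e (p ((v : l2) i)) by [].
  apply: filterS Fu => v.
  rewrite -!ball_normE/= => /l2_norm_lt uv; rewrite -pB.
  apply: le_lt_trans uv; apply: (le_trans (ple _)).
  apply: le_trans (l2_seminorm_le_norm i.+1 (u - v)).
  exact: (@l2_seminorm_coord i.+1 (val (u - v)) i).
have /cvg_ex[a /cvgrPdist_lt aP] := H (@complex.Re R) ltac:(by case=> ? ? []) Re_normc_le.
have /cvg_ex[b /cvgrPdist_lt bP] := H (@complex.Im R) ltac:(by case=> ? ? []) Im_normc_le.
exists (a +i* b)%C => e e0.
have e20 : 0 < e / 2 by rewrite divr_gt0.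
have Fa : \forall u \near F, `|a - complex.Re ((u : l2) i)| < e / 2 := aP _ e20.
have Fb : \forall u \near F, `|b - complex.Im ((u : l2) i)| < e / 2 := bP _ e20.
apply: filterS2 Fa Fb => u ua ub.
apply: (le_lt_trans (normc_le_ReIm _)); rewrite (splitr e) ltrD//.
  by move: ua; case: (u i) => c d; rewrite distrC.
by move: ub; case: (u i) => c d; rewrite distrC.
Qed.

(** The candidate limit is taken coordinatewise.  For [u] and [v] far along the
    filter the seminorms of [u - v] are small uniformly in the number of
    coordinates, and for each of them [v] can be replaced by the limit. *)
Lemma l2_complete (F : set_system l2) : ProperFilter F -> cauchy F -> cvg F.
Proof.
move=> FF Fc.
have /choice[z zP] := fun i => @l2_coord_cvg F i FF Fc.
have {}zP N (e : R) : 0 < e -> \forall u \near F, l2_seminorm N (val (u : l2) - z) < e.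
  move=> e0; have [d d0 dP] := l2_seminorm_coord0 N z e0.
  have : \forall u \near F, forall i : 'I_N, Normc.normc ((u : l2) i - z i) < d.
    by apply: filter_forall => i; exact: zP.
  apply: filterS => u uP; rewrite -opprB l2_seminormN; apply: dP => i iN.
  by rewrite -opprB normcN; exact: (uP (Ordinal iN)).
have key (e : R) : 0 < e -> \forall u \near F,
    forall N, l2_seminorm N (val (u : l2) - z) <= e.
  move=> e0; have e20 : 0 < e / 2 by rewrite divr_gt0.
  have /cauchyP /(_ (e / 2)%:C%C) [|w Fw] := Fc; first by rewrite ltcR.
  apply: filterS (Fw) => u; rewrite -ball_normE/= => uw N.
  apply/ler_addgt0Pr => d d0.
  have [v [vw vz]] := filter_ex (filterI Fw (zP N d d0)).
  move: vw; rewrite -ball_normE/= => vw.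
  have -> : val u - z = val (u - v) + (val v - z).
    by rewrite raddfB/= addrA subrK.
  apply: (le_trans (l2_seminormD _ _ _)); rewrite lerD//; last exact: ltW.
  apply: (le_trans (l2_seminorm_le_norm _ _)).
  have -> : u - v = (w - v) - (w - u) by rewrite opprB [RHS]addrC subrKA.
  apply: (le_trans (l2_normD _ _)); rewrite (splitr e) lerD//.
    exact/ltW/l2_norm_lt.
  have : `|- (w - u)| < (e / 2)%:C%C by rewrite normrN.
  by move/l2_norm_lt/ltW.
have zl2 : z \in l2_pred.
  have [u uP] := @filter_ex _ _ _ _ (key 1 ltr01).
  apply/l2_predP; exists (l2_norm u + 1) => N.
  have -> : z = val u - (val u - z) by rewrite subKr.
  apply: (le_trans (l2_seminormD _ _ _)); rewrite l2_seminormN lerD//.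
  exact: l2_seminorm_le_norm.
apply/cvg_ex; exists (L2Seq zl2); apply/cvgrPdist_le => e.
rewrite ltcE => /andP[/eqP ei e0].
have -> : e = (complex.Re e)%:C%C by case: (e) ei => a b /= ->.
apply: filterS (key _ e0) => u uP.
rewrite distrC l2_normE lecR; apply: l2_norm_le => N; exact: uP.
Qed.

HB.instance Definition _ := Uniform_isComplete.Build l2 l2_complete.


Definition l2_dotn N u v : C := \sum_(i < N) u i * (v i)^*.

Lemma l2_dotnC N u v : l2_dotn N u v = (l2_dotn N v u)^*.
Proof.
by rewrite rmorph_sum; apply: eq_bigr => i _; rewrite rmorphM/= conjCK mulrC.
Qed.

Lemma l2_dotnDl N a u v w :
  l2_dotn N (a *: u + v) w = a * l2_dotn N u w + l2_dotn N v w.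
Proof.
rewrite mulr_sumr -big_split/=; apply: eq_bigr => i _.
by rewrite l2D l2Z mulrDl mulrA.
Qed.

Lemma l2_dotn_sqr N u : l2_dotn N u u = (l2_seminorm N u ^+ 2)%:C%C.
Proof.
rewrite l2_seminorm_sqr rmorph_sum; apply: eq_bigr => i _.
by rewrite -sqr_normc/= rmorphXn.
Qed.

(** The series converges absolutely, since its terms are dominated by
    [|u_i|^2 + |v_i|^2]; it is applied to real and imaginary parts. *)
Lemma l2_dot_cvg (p : C -> R) u v :
  (forall a b, p (a + b) = p a + p b) -> (forall z, `|p z| <= Normc.normc z) ->
  cvgn (fun N => p (l2_dotn N u v)).
Proof.
move=> pD ple; have p0 : p 0 = 0.
  by apply: (addrI (p 0)); rewrite -pD !addr0.
have -> : (fun N => p (l2_dotn N u v)) = series (fun i => p (u i * (v i)^*)).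
  apply/funext => N; rewrite seriesEord/= /l2_dotn.
  by apply: (big_morph p pD p0).
apply: normed_cvg.
apply: (@series_le_cvg _ _ (fun i => Normc.normc (u i) ^+ 2 + Normc.normc (v i) ^+ 2)).
- by move=> i; exact: normr_ge0.
- by move=> i; rewrite addr_ge0// sqr_ge0.
- move=> i /=; apply: (le_trans (ple _)); rewrite Normc.normcM.
  have -> : Normc.normc (v i)^* = Normc.normc (v i).
    by case: (v i) => a b /=; rewrite sqrrN.
  have := sqr_ge0 (Normc.normc (u i) - Normc.normc (v i)).
  have := normc_ge0 (u i); have := normc_ge0 (v i).
  by move: (Normc.normc _) (Normc.normc _) => a b; nra.
have -> : series (fun i => Normc.normc (u i) ^+ 2 + Normc.normc (v i) ^+ 2) =
    (fun N => l2_seminorm N u ^+ 2 + l2_seminorm N v ^+ 2).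
  by apply/funext => N; rewrite !l2_seminorm_sqr seriesEord/= big_split.
by apply: is_cvgD; apply: (@is_cvgM _ nat \oo _ (l2_seminorm ^~ _));
  apply/cvg_ex; eexists; exact: l2_seminorm_cvg.
Qed.

Definition l2_dot u v : C :=
  (limn (fun N => complex.Re (l2_dotn N u v)) +i*
   limn (fun N => complex.Im (l2_dotn N u v)))%C.

Lemma l2_dot_Re u v :
  (fun N => complex.Re (l2_dotn N u v)) @ \oo --> complex.Re (l2_dot u v).
Proof.
apply: l2_dot_cvg => [|]; [by case=> a b [c d]|exact: Re_normc_le].
Qed.

Lemma l2_dot_Im u v :
  (fun N => complex.Im (l2_dotn N u v)) @ \oo --> complex.Im (l2_dot u v).
Proof.
apply: l2_dot_cvg => [|]; [by case=> a b [c d]|exact: Im_normc_le].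
Qed.

Lemma l2_dot_lim u v z :
  (fun N => complex.Re (l2_dotn N u v)) @ \oo --> complex.Re z ->
  (fun N => complex.Im (l2_dotn N u v)) @ \oo --> complex.Im z ->
  l2_dot u v = z.
Proof.
case: z => a b /= za zb.
have := cvg_unique _ (@l2_dot_Re u v) za; have := cvg_unique _ (@l2_dot_Im u v) zb.
by case: (l2_dot u v) => c d /= -> // -> .
Qed.

Lemma Re_conj (z : C) : complex.Re z^* = complex.Re z.
Proof. by case: z. Qed.
Lemma Im_conj (z : C) : complex.Im z^* = - complex.Im z.
Proof. by case: z. Qed.
Lemma ReMD (a z w : C) : complex.Re (a * z + w) =
  complex.Re a * complex.Re z - complex.Im a * complex.Im z + complex.Re w.
Proof. by case: a z w => ? ? [? ?] []. Qed.
Lemma ImMD (a z w : C) : complex.Im (a * z + w) =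
  complex.Re a * complex.Im z + complex.Im a * complex.Re z + complex.Im w.
Proof. by case: a z w => ? ? [? ?] []. Qed.

Lemma l2_dotC u v : l2_dot u v = (l2_dot v u)^*.
Proof.
apply: l2_dot_lim; under eq_fun do rewrite l2_dotnC ?Re_conj ?Im_conj.
  by rewrite Re_conj; exact: l2_dot_Re.
by rewrite Im_conj; apply: cvgN; exact: l2_dot_Im.
Qed.

Lemma l2_dot_linear a u v w :
  l2_dot (a *: u + v) w = a * l2_dot u w + l2_dot v w.
Proof.
apply: l2_dot_lim; under eq_fun do rewrite l2_dotnDl ?ReMD ?ImMD.
  rewrite ReMD; apply: cvgD; last exact: l2_dot_Re.
  by apply: cvgB; (apply: cvgM; first exact: cvg_cst);
    [exact: l2_dot_Re|exact: l2_dot_Im].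
rewrite ImMD; apply: cvgD; last exact: l2_dot_Im.
by apply: cvgD; (apply: cvgM; first exact: cvg_cst);
  [exact: l2_dot_Im|exact: l2_dot_Re].
Qed.

Lemma l2_dot_sqr u : l2_dot u u = (l2_norm u ^+ 2)%:C%C.
Proof.
apply: l2_dot_lim => /=; under eq_fun do rewrite l2_dotn_sqr/=.
  by apply: (@cvgM _ nat \oo _ (l2_seminorm ^~ u) (l2_seminorm ^~ u));
    exact: l2_seminorm_cvg.
exact: cvg_cst.
Qed.

Lemma l2_dot_bilinear :
  bilinear_for (@GRing.mul C : GRing.Scale.law C C)
     (Num.conj \; @GRing.mul C : GRing.Scale.law C C) l2_dot.
Proof.
split=> [w a u v|w a u v] /=; first exact: l2_dot_linear.
by rewrite l2_dotC l2_dot_linear [l2_dot w u]l2_dotC [l2_dot w v]l2_dotC rmorphD rmorphM.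
Qed.

HB.instance Definition _ := bilinear_isBilinear.Build C l2 l2 C
  (@GRing.mul C : GRing.Scale.law C C) (Num.conj \; @GRing.mul C : GRing.Scale.law C C) l2_dot
  l2_dot_bilinear.

Lemma l2_dot_hermitian u v : l2_dot u v = (-1) ^+ false * (l2_dot v u)^*.
Proof. by rewrite expr0 mul1r l2_dotC. Qed.

HB.instance Definition _ := isHermitianSesquilinear.Build C l2 false Num.conj
  l2_dot l2_dot_hermitian.

Lemma l2_dot_gt0 u : u != 0 -> 0 < l2_dot u u.
Proof.
move=> u0; rewrite l2_dot_sqr ltcR exprn_gt0// lt_def l2_norm_ge0 andbT.
by apply: contra u0 => /eqP u0; apply/eqP/l2_cnorm0_eq0; rewrite /l2_cnorm u0.
Qed.
HB.instance Definition _ := isDotProduct.Build C l2 l2_dot l2_dot_gt0.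

Lemma l2_norm_of_dot : norm_of_dot (l2_dot : {dot l2 for Num.conj}).
Proof. by move=> u; rewrite l2_normE -[RHS]/(l2_dot u u) l2_dot_sqr rmorphXn. Qed.

End l2.

(** * Positive semidefinite kernels *)

Lemma cvg_sumr (K : numFieldType) (V : normedModType K) (T : Type)
    (F : set_system T) (I : Type) (r : seq I) (f : I -> T -> V) (a : I -> V) :
  Filter F -> (forall i, f i @ F --> a i) ->
  (fun t => \sum_(i <- r) f i t) @ F --> \sum_(i <- r) a i.
Proof.
by move=> FF fa; apply: cvg_big => [|i _]; [exact: add_continuous|exact: fa].
Qed.

Section psd.
Variable R : realType.
Implicit Types (n : nat) (c : nat -> R).

Definition quad_form (T : Type) (k : T -> T -> R) n (x : nat -> T) c : R :=
  \sum_(i < n) \sum_(j < n) c i * c j * k (x i) (x j).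

Definition psd (T : Type) (k : T -> T -> R) : Prop :=
  (forall s t, k s t = k t s) /\ forall n x c, 0 <= quad_form k n x c.

Lemma quad_formS T (k : T -> T -> R) n x c : (forall s t, k s t = k t s) ->
  quad_form k n.+1 x c = quad_form k n x c
    + 2 * c n * (\sum_(i < n) c i * k (x i) (x n)) + c n ^+ 2 * k (x n) (x n).
Proof.
move=> kC; rewrite /quad_form big_ord_recr/=.
under eq_bigr do rewrite big_ord_recr/=.
rewrite big_split/= big_ord_recr/=.
have -> : \sum_(i < n) c n * c i * k (x n) (x i) =
    c n * \sum_(i < n) c i * k (x i) (x n).
  by rewrite mulr_sumr; apply: eq_bigr => i _; rewrite kC mulrA.
have -> : \sum_(i < n) c i * c n * k (x i) (x n) =
    c n * \sum_(i < n) c i * k (x i) (x n).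
  by rewrite mulr_sumr; apply: eq_bigr => i _; rewrite mulrA (mulrC (c n)).
by ring.
Qed.

Lemma psd_pull S T (f : S -> T) (k : T -> T -> R) :
  psd k -> psd (fun s t => k (f s) (f t)).
Proof. by move=> [kC k0]; split=> [s t|n x c]; [exact: kC|exact: k0 n (f \o x) c]. Qed.

Lemma psd_diag T (k : T -> T -> R) t : psd k -> 0 <= k t t.
Proof.
move=> [_ /(_ 1%N (fun=> t) (fun=> 1))].
by rewrite /quad_form !big_ord1 !mul1r.
Qed.

(** The form at [s + a t] is affine in [a], so it can stay nonnegative only if its
    slope vanishes. *)
Lemma psd_diag0 T (k : T -> T -> R) s t : psd k -> k t t = 0 -> k s t = 0.
Proof.
move=> [kC k0] kt.
have H (a : R) : 0 <= k s s + 2 * a * k s t.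
  have := k0 2%N (fun i => if i == 0%N then s else t) (fun i => if i == 0%N then 1 else a).
  by rewrite quad_formS// /quad_form !big_ord1/= kt !mul1r mulr0 addr0.
have [//|nz] := eqVneq (k s t) 0; have := H (- (k s s + 1) / (2 * k s t)).
have -> : 2 * (- (k s s + 1) / (2 * k s t)) * k s t = - (k s s + 1).
  by field.
lra.
Qed.

(** Completing the square: the form of the reduced kernel at [c] is the form of
    [k] at [c] extended by the weight of the point [m] that minimizes it. *)
Lemma psd_reduce T (k : T -> T -> R) (m : T) : psd k ->
  psd (fun s t => k s t - k s m * k t m / k m m).
Proof.
move=> kP; have [kC k0] := kP.
split=> [s t|n x c]; first by rewrite kC (mulrC (k s m)).
have [km0|km0] := eqVneq (k m m) 0.
  have -> : (fun s t => k s t - k s m * k t m / k m m) = k; last exact: k0.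
  by apply/funext => s; apply/funext => t; rewrite km0 invr0 mulr0 subr0.
pose L := \sum_(i < n) c i * k (x i) m.
pose y i := if (i < n)%N then x i else m.
pose d i := if (i < n)%N then c i else - L / k m m.
have := k0 n.+1 y d; rewrite quad_formS//.
have -> : quad_form k n y d = quad_form k n x c.
  by apply: eq_bigr => i _; apply: eq_bigr => j _; rewrite /y /d !ltn_ord.
have -> : \sum_(i < n) d i * k (y i) (y n) = L.
  by apply: eq_bigr => i _; rewrite /y /d ltn_ord ltnn.
rewrite /y /d ltnn.
have -> : quad_form (fun s t => k s t - k s m * k t m / k m m) n x c =
    quad_form k n x c - L ^+ 2 / k m m.
  rewrite /quad_form expr2 {1}/L mulr_suml mulr_suml -sumrB; apply: eq_bigr => i _.
  rewrite mulr_sumr mulr_suml -sumrB; apply: eq_bigr => j _.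
  by field.
by congr (_ <= _); field.
Qed.

(** Successive Schur complements: the kernel that is left of [k] once the points
    [0, ..., m - 1] have been eliminated. *)
Fixpoint cholesky_rest (k : nat -> nat -> R) m : nat -> nat -> R :=
  if m is m'.+1 then
    let l := cholesky_rest k m' in fun i j => l i j - l i m' * l j m' / l m' m'
  else k.

(** Where the pivot [l m m] vanishes the quotient is 0 by convention, and this is
    the right value because the whole column [m] of [l] vanishes then. *)
Definition cholesky (k : nat -> nat -> R) i m : R :=
  let l := cholesky_rest k m in l i m / Num.sqrt (l m m).

Lemma cholesky_rest_psd k m : psd k -> psd (cholesky_rest k m).
Proof. by move=> kP; elim: m => //= m IH; exact: psd_reduce. Qed.

Lemma cholesky_rest0 k m i j : psd k -> (j < m)%N -> cholesky_rest k m i j = 0.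
Proof.
move=> kP; elim: m i j => //= m IH i j.
have lP := cholesky_rest_psd m kP.
rewrite ltnS leq_eqVlt => /predU1P[->|jm]; last first.
  by rewrite (IH i j jm) (lP.1 j) (IH m j jm) mulr0 mul0r subr0.
have [l0|l0] := eqVneq (cholesky_rest k m m m) 0.
  by rewrite (psd_diag0 i lP l0) l0 invr0 mulr0 subr0.
by rewrite mulfK// subrr.
Qed.

Lemma cholesky_sum k n i j : psd k ->
  k i j = cholesky_rest k n i j + \sum_(m < n) cholesky k i m * cholesky k j m.
Proof.
move=> kP; elim: n => [|n ->]; first by rewrite big_ord0 addr0.
rewrite big_ord_recr/= /cholesky.
have l0 := psd_diag n (cholesky_rest_psd n kP).
rewrite mulrACA -invfM -expr2 sqr_sqrtr//; ring.
Qed.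

(** Eliminating the first [n] points annihilates the kernel at these points, so the
    coordinates below [n] already give the whole inner product. *)
Lemma psd_cholesky k n i j : psd k -> (i < n)%N ->
  k i j = \sum_(m < n) cholesky k i m * cholesky k j m.
Proof.
move=> kP jn; rewrite {1}(cholesky_sum n i j kP) (cholesky_rest_psd n kP).1.
by rewrite cholesky_rest0// add0r.
Qed.

Lemma cholesky0 k i m : psd k -> (i < m)%N -> cholesky k i m = 0.
Proof.
move=> kP im; rewrite /cholesky (cholesky_rest_psd m kP).1.
by rewrite cholesky_rest0// mul0r.
Qed.

Lemma psd_outer T (f : T -> R) : psd (fun s t => f s * f t).
Proof.
split=> [s t|n x c]; first exact: mulrC.
have -> : quad_form (fun s t => f s * f t) n x c = (\sum_(i < n) c i * f (x i)) ^+ 2.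
  rewrite expr2 mulr_suml; apply: eq_bigr => i _; rewrite mulr_sumr.
  by apply: eq_bigr => j _; ring.
exact: sqr_ge0.
Qed.

Lemma psd_mul_outer T (k : T -> T -> R) (f : T -> R) :
  psd k -> psd (fun s t => f s * f t * k s t).
Proof.
move=> [kC k0]; split=> [s t|n x c]; first by rewrite kC (mulrC (f s)).
have := k0 n x (fun i => c i * f (x i)); congr (_ <= _).
by apply: eq_bigr => i _; apply: eq_bigr => j _; ring.
Qed.

Lemma psdD T (k l : T -> T -> R) : psd k -> psd l -> psd (fun s t => k s t + l s t).
Proof.
move=> [kC k0] [lC l0]; split=> [s t|n x c]; first by rewrite kC lC.
have := addr_ge0 (k0 n x c) (l0 n x c); congr (_ <= _).
rewrite -big_split; apply: eq_bigr => i _; rewrite -big_split.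
by apply: eq_bigr => j _/=; rewrite mulrDr.
Qed.

Lemma psdZ T (k : T -> T -> R) a : 0 <= a -> psd k -> psd (fun s t => a * k s t).
Proof.
move=> a0 [kC k0]; split=> [s t|n x c]; first by rewrite kC.
have := mulr_ge0 a0 (k0 n x c); congr (_ <= _).
rewrite mulr_sumr; apply: eq_bigr => i _; rewrite mulr_sumr.
by apply: eq_bigr => j _; ring.
Qed.

Lemma psd_sum T (k : nat -> T -> T -> R) N : (forall m, psd (k m)) ->
  psd (fun s t => \sum_(m < N) k m s t).
Proof.
move=> kP; elim: N => [|N IH].
  split=> [s t|n x c]; first by rewrite !big_ord0.
  by rewrite /quad_form big1// => i _; rewrite big1// => j _; rewrite big_ord0 mulr0.
have := psdD IH (kP N); congr psd.
by apply/funext => s; apply/funext => t; rewrite big_ord_recr.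
Qed.

(** Schur product theorem: writing one factor as a Gram matrix splits the
    product into kernels that are the other factor weighted by a function. *)
Lemma psdM T (k l : T -> T -> R) : psd k -> psd l -> psd (fun s t => k s t * l s t).
Proof.
move=> kP lP; split=> [s t|n x c]; first by rewrite kP.1 lP.1.
have kxP := psd_pull x kP; have lxP := psd_pull x lP.
pose r := cholesky (fun i j => k (x i) (x j)).
have : psd (fun i j => \sum_(m < n) (r i m * r j m * l (x i) (x j))).
  apply: (@psd_sum nat (fun m i j => r i m * r j m * l (x i) (x j))) => m.
  exact: psd_mul_outer.
move=> -[_ /(_ n id c)]; congr (_ <= _).
apply: eq_bigr => i _; apply: eq_bigr => j _ /=.
by rewrite -mulr_suml -[X in X * l _ _](psd_cholesky _ kxP).
Qed.

Lemma psdX T (k : T -> T -> R) m : psd k -> psd (fun s t => k s t ^+ m).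
Proof.
move=> kP; elim: m => [|m IH].
  by have := psd_outer (fun _ : T => 1); congr psd; apply/funext => s;
    apply/funext => t; rewrite expr0 mul1r.
have := psdM kP IH; congr psd.
by apply/funext => s; apply/funext => t; rewrite exprS.
Qed.

Lemma psd_lim T (k : nat -> T -> T -> R) (l : T -> T -> R) :
  (forall m, psd (k m)) -> (forall s t, k ^~ s ^~ t @ \oo --> l s t) -> psd l.
Proof.
move=> kP kl; split=> [s t|n x c].
  apply: (cvg_unique _ (kl s t)) => //.
  have -> : (fun m => k m s t) = (fun m => k m t s); last exact: kl.
  by apply/funext => m; rewrite (kP m).1.
have H : (fun m => quad_form (k m) n x c) @ \oo --> quad_form l n x c.
  apply: cvg_sumr => i; apply: cvg_sumr => j.
  by apply: cvgM; [exact: cvg_cst|exact: kl].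
rewrite -(cvg_lim (@Rhausdorff R) H); apply: limr_ge; first by apply/cvg_ex; eexists;
  exact: H.
by apply: nearW => m; exact: (kP m).2.
Qed.

Lemma psd_expR T (k : T -> T -> R) : psd k -> psd (fun s t => expR (k s t)).
Proof.
move=> kP; apply: (@psd_lim _ (fun N s t => \sum_(m < N) exp_coeff (k s t) m)).
  move=> N; apply: (@psd_sum _ (fun m s t => exp_coeff (k s t) m)) => m.
  have a0 : 0 <= m`!%:R^-1 :> R by rewrite invr_ge0 ler0n.
  by have := psdZ a0 (psdX m kP); congr psd; apply/funext => s; apply/funext => t;
    rewrite /exp_coeff/= mulrC.
move=> s t; have := is_cvg_series_exp_coeff (k s t).
apply: cvg_trans; apply: near_eq_cvg; apply: nearW => N.
by rewrite seriesEord.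
Qed.

(** The Gram kernel of the vectors translated so that [o] becomes the origin. *)
Lemma psd_rebase T (k : T -> T -> R) (o : T) : psd k ->
  psd (fun s t => k s t - k s o - k o t + k o o).
Proof.
move=> [kC k0]; split=> [s t|n x c].
  by rewrite (kC s t) (kC s o) (kC o t); ring.
pose S := \sum_(i < n) c i.
pose y i := if (i < n)%N then x i else o.
pose d i := if (i < n)%N then c i else - S.
have := k0 n.+1 y d; rewrite quad_formS//; congr (_ <= _).
have -> : quad_form k n y d = quad_form k n x c.
  by apply: eq_bigr => i _; apply: eq_bigr => j _; rewrite /y /d !ltn_ord.
have -> : \sum_(i < n) d i * k (y i) (y n) = \sum_(i < n) c i * k (x i) o.
  by apply: eq_bigr => i _; rewrite /y /d ltn_ord ltnn.
rewrite /y /d ltnn; set L := \sum_(i < n) _.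
have -> : quad_form (fun s t => k s t - k s o - k o t + k o o) n x c =
    quad_form k n x c - L * S - S * L + S * S * k o o.
  have -> : L * S = \sum_(i < n) \sum_(j < n) c i * c j * k (x i) o.
    rewrite mulr_suml; apply: eq_bigr => i _; rewrite mulr_sumr.
    by apply: eq_bigr => j _; ring.
  have -> : S * L = \sum_(i < n) \sum_(j < n) c i * c j * k o (x j).
    rewrite mulr_suml; apply: eq_bigr => i _; rewrite mulr_sumr.
    by apply: eq_bigr => j _; rewrite kC; ring.
  have -> : S * S * k o o = \sum_(i < n) \sum_(j < n) c i * c j * k o o.
    rewrite mulr_suml mulr_suml; apply: eq_bigr => i _; rewrite mulr_sumr mulr_suml.
    by apply: eq_bigr.
  rewrite -!sumrB -big_split; apply: eq_bigr => i _ /=.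
  rewrite -!sumrB -big_split; apply: eq_bigr => j _ /=; ring.
ring.
Qed.

End psd.

(** * Compact sets and partitions of unity in topological groups *)

Lemma sum_ord_widen (V : nmodType) (f : nat -> V) n m : (n <= m)%N ->
  (forall i, (n <= i)%N -> f i = 0) -> \sum_(i < m) f i = \sum_(i < n) f i.
Proof.
move=> nm f0; rewrite -(subnKC nm) big_split_ord/= [X in _ + X]big1 ?addr0// => i _.
by rewrite f0// leq_addr.
Qed.

Lemma sum_ord_cutoff (V : nmodType) (f : nat -> V) n m :
  (forall i, (n <= i)%N -> f i = 0) -> (forall i, (m <= i)%N -> f i = 0) ->
  \sum_(i < n) f i = \sum_(i < m) f i.
Proof.
move=> n0 m0; have [nm|/ltnW mn] := leqP n m.
  by rewrite (sum_ord_widen nm).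
exact: sum_ord_widen.
Qed.

Section topological_group.
Variable G : topologicalGroupType.
Implicit Types (A B K V : set G) (g h : G).

Definition mulset A B : set G := [set (a * b)%g | a in A & b in B].
Definition invset A : set G := [set a^-1%g | a in A].

Lemma mulset_compact A B : compact A -> compact B -> compact (mulset A B).
Proof.
move=> cA cB; have -> : mulset A B = (fun p : G * G => (p.1 * p.2)%g) @` (A `*` B).
  apply/seteqP; split=> [_ [a Aa [b Bb <-]]|_ [[a b] [/= Aa Bb] <-]].
    by exists (a, b).
  by exists a => //; exists b.
apply: continuous_compact; last exact: compact_setX.
exact/continuous_subspaceT/mulg_continuous.
Qed.

Lemma invset_compact A : compact A -> compact (invset A).
Proof.
by move=> cA; apply: continuous_compact => //;
  exact/continuous_subspaceT/invg_continuous.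
Qed.

Lemma mulgl_continuous g : continuous (fun h => (g * h)%g).
Proof.
move=> h; apply: (@cvg_comp _ _ _ (fun h => (g, h)) (fun p : G * G => (p.1 * p.2)%g)
   _ (nbhs (g, h))); last exact: (@mulg_continuous G (g, h)).
by apply: cvg_pair; [exact: cvg_cst|exact: cvg_id].
Qed.

Lemma translate_compact g V : compact V -> compact [set (g * v)%g | v in V].
Proof.
by move=> cV; apply: continuous_compact => //;
  exact/continuous_subspaceT/mulgl_continuous.
Qed.

Lemma nbhs_translate g V : nbhs 1%g V -> nbhs g [set h | V (g^-1 * h)%g].
Proof.
move=> V1; have := @mulgl_continuous g^-1%g g V; rewrite /= mulVg; exact.
Qed.

Lemma second_countable_enum (T : topologicalType) (x0 : T) : @second_countable T ->
  exists b : nat -> set T, forall x U, nbhs x U -> exists n, [/\ nbhs x (b n), b n x & b n `<=` U].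
Proof.
case=> B /countable_injP[f finj] [Bop Bb].
exists (fun n => get [set b | B b /\ f b = n]) => x U /(Bb x)[b [Bb' bx] bU].
exists (f b);
  have [gB gE] : [set b' | B b' /\ f b' = f b] (get [set b' | B b' /\ f b' = f b]).
  by apply: (@getPex _ _); exists b.
rewrite (finj _ _ _ _ gE) ?inE//; split => //.
by apply: open_nbhs_nbhs; split => //; exact: Bop.
Qed.

Variable R : realType.
Hypothesis lcscG : lcsc G.

Lemma lcsc_compact_nbhs : exists V : set G, [/\ compact V, closed V & nbhs 1%g V].
Proof.
have [_ lc _] := lcscG; have [U U1 [cU clU]] := lc 1%g I.
have {}U1 : \forall g \near 1%g, [set: G] g -> U g := U1.
by exists U; split=> //; apply: filterS U1 => g; exact.
Qed.

(** Urysohn's function separates 1 from the complement of [V]; truncating its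
    affine image makes it constant on a neighbourhood of 1. *)
Lemma lcsc_bump : exists (f : G -> R) (V W : set G),
  [/\ continuous f, compact V & nbhs 1%g W] /\
  [/\ forall g, 0 <= f g, forall g, f g <= 1, forall g, f g != 0 -> V g
    & forall g, W g -> f g = 1].
Proof.
have [V [cV clV V1]] := lcsc_compact_nbhs; have [hG lcG _] := lcscG.
have sepV : uniform_separator [set 1%g] (~` V°).
  apply: (@locally_compact_completely_regular G R lcG hG).
    exact/open_closedC/open_interior.
  by apply; exact: V1.
pose f0 := @Urysohn G R [set 1%g] (~` V°).
have f0c : continuous f0 by exact: Urysohn_continuous.
have f0r g : 0 <= f0 g <= 1.
  by have /= := @Urysohn_range G R [set 1%g] (~` V°) (f0 g); rewrite in_itv/=; apply;
    exists g.
exists (fun g => Num.min 1 (2 - 2 * f0 g)), V, [set g | f0 g < 2^-1]; split; split => //.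
- move=> g; apply: (@continuous_min _ _ (cst 1) (fun g => 2 - 2 * f0 g));
    first exact: cvg_cst.
  by apply: cvgB; [exact: cvg_cst|apply: cvgM; [exact: cvg_cst|exact: f0c]].
- have f01 : f0 1%g = 0 by apply: (Urysohn_sub0 sepV); exists 1%g.
  apply: (f0c 1%g [set x | x < 2^-1]); rewrite f01.
  by apply: open_nbhs_nbhs; split; [exact: open_lt|rewrite /= invr_gt0].
- by move=> g; rewrite le_min ler01/=; have := f0r g; lra.
- by move=> g; rewrite ge_min lexx.
- move=> g; apply: contraNP => nV; apply/eqP.
  have -> : f0 g = 1.
    by apply: (Urysohn_sub1 sepV); exists g => //= /interior_subset.
  by rewrite mulr1 subrr; apply: min_r; exact: ler01.
- move=> g /= fg; rewrite min_l//; have : 2 * 2^-1 = 1 :> R by rewrite divff.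
  by nra.
Qed.

(** A locally finite partition of unity subordinate to the translates of a
    compact set [V]; finiteness is expressed by the partial sums being locally
    eventually equal to 1. *)
Record unity (V : set G) (p : nat -> G) (phi : nat -> G -> R) : Prop := {
  unity_compact : compact V;
  unity_continuous : forall i, continuous (phi i);
  unity_ge0 : forall i g, 0 <= phi i g;
  unity_supp : forall i g, phi i g != 0 -> V ((p i)^-1 * g)%g;
  unity_sum : forall g, exists N, \forall h \near g,
    forall n, (N <= n)%N -> \sum_(i < n) phi i h = 1
}.

(** With bumps [f_i] equal to 1 on translates that cover the group,
    [f_i * \prod_(j < i) (1 - f_j)] has partial sums [1 - \prod_(j < n) (1 - f_j)],
    and these equal 1 near any point as soon as one factor vanishes there. *)
Lemma lcsc_unity : exists V p phi, unity V p phi.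
Proof.
have [f [V [W [[fc cV W1] [f0 f1 fV fW]]]]] := lcsc_bump.
have [_ _ scG] := lcscG; have [b bP] := second_countable_enum 1%g scG.
have [p pP] : exists p : nat -> G, forall g, exists n,
    \forall h \near g, W ((p n)^-1 * h)%g.
  exists (fun n => get [set p | forall h, b n h -> W (p^-1 * h)%g]) => g.
  have [n [bn bng bW]] := bP _ _ (nbhs_translate g W1); exists n.
  apply: filterS bn; apply: (@getPex _ [set p | forall h, b n h -> W (p^-1 * h)%g]).
  by exists g.
pose F i g := f ((p i)^-1 * g)%g.
have Fc i : continuous (F i).
  move=> g; apply: (@continuous_comp _ _ _ (fun g => (p i)^-1 * g)%g f).
    exact: mulgl_continuous.
  exact: fc.
have pc i : continuous (fun g => \prod_(j < i) (1 - F j g)).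
  move=> g; elim: i => [|i IH].
    by under eq_fun do rewrite big_ord0; exact: cvg_cst.
  under eq_fun do rewrite big_ord_recr/=.
  by apply: cvgM => //; apply: cvgB; [exact: cvg_cst|exact: Fc].
exists V, p, (fun i g => F i g * \prod_(j < i) (1 - F j g)); split => //.
- by move=> i g; apply: cvgM; [exact: Fc|exact: pc].
- by move=> i g; rewrite mulr_ge0 ?f0// prodr_ge0// => j _; rewrite subr_ge0 f1.
- by move=> i g; rewrite mulf_eq0 => /norP[/fV].
- move=> g; have [n nP] := pP g; exists n.+1.
  apply: filterS nP => h Wh m nm.
  have -> : forall m, \sum_(i < m) F i h * \prod_(j < i) (1 - F j h) =
      1 - \prod_(j < m) (1 - F j h).
    elim=> [|k IH]; first by rewrite !big_ord0 subrr.
    by rewrite !big_ord_recr/= IH; ring.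
  rewrite (bigD1 (Ordinal nm))//= (_ : F n h = 1); last exact: fW.
  by rewrite subrr mul0r subr0.
Qed.

Section unity_theory.
Variables (V : set G) (p : nat -> G) (phi : nat -> G -> R).
Hypothesis phiP : unity V p phi.

Lemma unity_near g : exists N, \forall h \near g,
  \sum_(i < N) phi i h = 1 /\ forall i, (N <= i)%N -> phi i h = 0.
Proof.
have [N NP] := unity_sum phiP g; exists N.
apply: filterS NP => h hP; split=> [|i Ni]; first exact: hP.
have := hP i.+1 (leqW Ni); rewrite big_ord_recr/= hP// => si.
by apply: (addrI 1); rewrite addr0.
Qed.

Lemma unity_at g : exists N,
  \sum_(i < N) phi i g = 1 /\ forall i, (N <= i)%N -> phi i g = 0.
Proof. by have [N /nbhs_singleton] := unity_near g; exists N. Qed.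

Lemma unity_pick g : exists i, phi i g != 0.
Proof.
have [N [sN _]] := unity_at g.
apply: contrapT => /forallNP H; have : (1 : R) != 0 by rewrite oner_eq0.
by rewrite -sN big1 ?eqxx// => i _; apply/eqP/negPn/negP; exact: H.
Qed.

Lemma unity_cover g : exists i, V ((p i)^-1 * g)%g.
Proof. by have [i /(unity_supp phiP)] := unity_pick g; exists i. Qed.

(** Near each point finitely many functions sum to 1, so finitely many translates
    of [V] cover a neighbourhood of that point. *)
Lemma compact_sub_cover K : compact K -> exists N, forall g, K g ->
  exists2 i, (i < N)%N & V ((p i)^-1 * g)%g.
Proof.
have /choice[n nP] : forall g, exists N, \forall h \near g,
    exists2 i, (i < N)%N & V ((p i)^-1 * h)%g.
  move=> g; have [N NP] := unity_near g; exists N.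
  apply: filterS NP => h [sN zN]; apply: contrapT => /forall2NP nV.
  have : (1 : R) != 0 by rewrite oner_eq0.
  rewrite -sN big1 ?eqxx// => i _; apply/eqP/negPn/negP => /(unity_supp phiP).
  by have [|] := nV i => //; rewrite ltn_ord.
rewrite compact_cover => cK.
have [D _ DK] : finite_subset_cover [set: G]
    (fun g => [set h | exists2 i, (i < n g)%N & V ((p i)^-1 * h)%g]°) K.
  apply: cK => [g _|g Kg]; first exact: open_interior.
  by exists g => //; exact: nP.
exists (\max_(g <- finmap.enum_fset D) n g)%N => g.
move=> /DK[h hD /interior_subset[i iN Vi]]; exists i => //.
by apply: leq_trans iN _; apply: leq_bigmax_seq.
Qed.

End unity_theory.

End topological_group.

(** * Vectors and positions attached to a proper cocycle *)

Section borel_measurability.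
Variables (R : realType) (d : measure_display) (X : measurableType d).

Lemma borel_open (H : ptopologicalType) (U : set H) : open U -> measurable (U : set (borel H)).
Proof. by move=> oU; exact: sub_sigma_algebra. Qed.

Lemma borel_compact (H : ptopologicalType) (L : set H) :
  hausdorff_space H -> compact L -> measurable (L : set (borel H)).
Proof.
move=> hH /(compact_closed hH) cL; rewrite -[L]setCK.
apply: measurableC; apply: borel_open; exact: closed_openC.
Qed.

Lemma borel_comp (H T : ptopologicalType) (phi : H -> T) (f : X -> H) :
  continuous phi -> measurable_fun [set: X] (f : X -> borel H) ->
  measurable_fun [set: X] (phi \o f : X -> borel T).
Proof.
move=> /continuousP cphi mf.
apply: (@measurability _ _ X (borel T) setT (phi \o f) (@open T)) => //.
move=> _ [B oB <-]; rewrite setTI comp_preimage -[X in measurable X]setTI.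
by apply: mf => //; apply: borel_open; exact: cphi.
Qed.

Lemma borel_compR (H : ptopologicalType) (phi : H -> R) (f : X -> H) :
  continuous phi -> measurable_fun [set: X] (f : X -> borel H) ->
  measurable_fun [set: X] (phi \o f).
Proof.
move=> /continuousP cphi mf; apply: (measurability _ (RGenOpens.measurableE R)).
move=> _ [_ [a [b ->] <-]]; rewrite setTI comp_preimage -[X in measurable X]setTI.
by apply: mf => //; apply: borel_open; apply: cphi; exact: interval_open.
Qed.

Lemma measurable_sqrt (f : X -> R) : measurable_fun [set: X] f ->
  measurable_fun [set: X] (fun x => Num.sqrt (f x)).
Proof.
move=> mf; apply: (measurableT_comp (f := @Num.sqrt R)) => //.
by apply: continuous_measurable_fun; exact: sqrt_continuous.
Qed.

Lemma cmeasurable_normc (f : X -> R[i]) : cmeasurable f ->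
  measurable_fun [set: X] (fun x => Normc.normc (f x)).
Proof.
move=> [mr mi].
have -> : (fun x => Normc.normc (f x)) =
    (fun x => Num.sqrt (complex.Re (f x) ^+ 2 + complex.Im (f x) ^+ 2)).
  by apply/funext => x; case: (f x).
by apply/measurable_sqrt/measurable_funD; exact: measurable_funX.
Qed.

Lemma cmeasurableB (f g : X -> R[i]) :
  cmeasurable f -> cmeasurable g -> cmeasurable (f \- g)%R.
Proof.
move=> [fr fi] [gr gi]; split.
  have -> : (fun x => complex.Re ((f \- g)%R x)) =
     (fun x => complex.Re (f x)) \- (fun x => complex.Re (g x)).
    by apply/funext => x /=; case: (f x) (g x) => ? ? [].
  exact: measurable_funB.
have -> : (fun x => complex.Im ((f \- g)%R x)) =
   (fun x => complex.Im (f x)) \- (fun x => complex.Im (g x)).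
  by apply/funext => x /=; case: (f x) (g x) => ? ? [].
exact: measurable_funB.
Qed.

End borel_measurability.

Lemma normc_dist (R : realType) (a b : R[i]) :
  `|Normc.normc a - Normc.normc b| <= Normc.normc (a - b).
Proof. exact: (@ler_dist_dist R (Rcomplex R) a b). Qed.

Section L2norm.
Variables (R : realType) (d : measure_display) (X : measurableType d).
Variable mu : {measure set X -> \bar R}.
Implicit Types f g : X -> R[i].

Definition sq_integral f : \bar R := (\int[mu]_x (Normc.normc (f x) ^+ 2)%:E)%E.

Lemma sq_integral_ge0 f : (0 <= sq_integral f)%E.
Proof. by apply: integral_ge0 => x _; rewrite lee_fin sqr_ge0. Qed.

Lemma L2normE f : L2norm mu f = (sq_integral f `^ 2^-1)%E.
Proof.
rewrite /L2norm unlock; congr (_ `^ _)%E; apply: eq_integral => x _ /=.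
by rewrite ger0_norm ?normc_ge0// powR_mulrn// normc_ge0.
Qed.

Lemma L2norm_fin f (r : R) : 0 <= r -> sq_integral f = r%:E ->
  L2norm mu f = (Num.sqrt r)%:E.
Proof. by move=> r0 fr; rewrite L2normE fr /= powR12_sqrt. Qed.

Lemma L2norm_lt f (e : R) : 0 < e ->
  (L2norm mu f < e%:E)%E <-> (sq_integral f < (e ^+ 2)%:E)%E.
Proof.
move=> e0; have := sq_integral_ge0 f; case E : (sq_integral f) => [r||] //= r0.
  rewrite (L2norm_fin _ E)// !lte_fin -(ltr_pXn2r (n := 2))// ?nnegrE ?sqrtr_ge0 ?ltW//.
  by rewrite sqr_sqrtr.
rewrite L2normE E; split; last by [].
by rewrite poweRyr ?invr_eq0.
Qed.

Lemma L2norm1 f : L2norm mu f = 1%E <-> sq_integral f = 1%E.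
Proof.
have := sq_integral_ge0 f; case E : (sq_integral f) => [r||] //= r0.
  rewrite (L2norm_fin _ E)//; split=> -[].
    by move=> /(congr1 (fun x => x ^+ 2)); rewrite sqr_sqrtr// expr1n => ->.
  by move=> ->; rewrite sqrtr1.
by rewrite L2normE E; split => //; rewrite poweRyr ?invr_eq0.
Qed.

End L2norm.

Section core.
Variables (R : realType) (G H : topologicalGroupType).
Variables (d : measure_display) (X : measurableType d) (mu : probability X R).
Variables (act : G -> X -> X) (omega : G -> X -> H) (F : set (set X)).
Hypothesis lcscH : lcsc H.
Hypothesis actP : nonsingular_action mu act.
Hypothesis omegaP : is_cocycle mu act omega.
Hypothesis Fmeas : F `<=` measurable.
Hypothesis omega_proper : proper_cocycle mu act omega F.
Hypothesis GX_A : pair_property_A mu act F.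

Lemma act_measurable g : measurable_fun [set: X] (act g).
Proof.
exact: (measurable_fun_pair2 (g : borel G) (action_measurable actP)).
Qed.

Lemma omega_measurable g : measurable_fun [set: X] (omega g : X -> borel H).
Proof.
exact: (measurable_fun_pair2 (g : borel G) (cocycle_measurable omegaP)).
Qed.

Lemma act_preimage_measurable g (A : set X) :
  measurable A -> measurable (act g @^-1` A).
Proof. by move=> mA; rewrite -[X in measurable X]setTI; exact: act_measurable. Qed.

Lemma ae_act g (P : X -> Prop) :
  {ae mu, forall x, P x} -> {ae mu, forall x, P (act g x)}.
Proof.
move=> [N [mN N0 PN]]; exists (act g @^-1` N); split.
- exact: act_preimage_measurable.
- exact/(action_null actP g mN).
- by move=> x nP; exact: PN.
Qed.

Lemma act_image g (A : set X) : act g @` A = act g^-1%g @^-1` A.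
Proof.
apply/seteqP; split=> [_ [x Ax <-]|x Ax].
  by rewrite /preimage/= -(actionM actP) mulVg (action1 actP).
by exists (act g^-1%g x) => //; rewrite -(actionM actP) mulgV (action1 actP).
Qed.

(** The cocycle identity for [g^-1 = (g^-1 h) h^-1], solved for the middle factor. *)
Lemma cocycle_quotient g h : {ae mu, forall x,
  (omega g^-1 x * (omega h^-1 x)^-1 = omega (g^-1 * h) (act h^-1 x))%g}.
Proof.
apply: filterS (cocycleM omegaP (g^-1 * h)%g h^-1%g) => x.
by rewrite -mulgA mulgV mulg1 => ->; rewrite -mulgA mulgV mulg1.
Qed.

(** What the two permanence results take from the action: unit vectors
    [q_g] of L^2(X) together with maps [s_g] into [H], the value of [s_g] at [x]
    being the position in [H] that the cocycle assigns to [g] from [x].  Where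
    both [q_g] and [q_h] are supported, [s_g] and [s_h] are close exactly when
    [g] and [h] are. *)
Lemma proper_cocycle_field (K : set G) (e : R) : compact K -> 0 < e ->
  exists (q : G -> X -> R) (s : G -> X -> H),
  [/\ forall g, measurable_fun [set: X] (q g),
      forall g x, 0 <= q g x,
      forall g, (\int[mu]_x (q g x ^+ 2)%:E = 1)%E
    & forall g, measurable_fun [set: X] (s g : X -> borel H)] /\
  [/\ forall g h, K (g^-1 * h)%g ->
        (\int[mu]_x ((q g x - q h x) ^+ 2)%:E <= e%:E)%E,
      exists2 L : set H, compact L & forall g h, K (g^-1 * h)%g ->
        {ae mu, forall x, q g x != 0 -> q h x != 0 -> L ((s g x)^-1 * s h x)%g}
    & forall L : set H, compact L -> exists2 C : set G, compact C &
        forall g h, ~ C (g^-1 * h)%g ->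
        {ae mu, forall x, q g x != 0 -> q h x != 0 -> ~ L ((s g x)^-1 * s h x)%g}].
Proof.
move=> cK e0.
have [xi [xi1 _ xiK [A FA xiA]]] := GX_A cK (e := Num.sqrt e) ltac:(by rewrite sqrtr_gt0).
have mA := Fmeas FA.
pose q g x := Normc.normc (xi g x) * \1_(act g^-1%g @^-1` A) x : R.
have mxi g : measurable_fun [set: X] (fun x => Normc.normc (xi g x)).
  by apply: cmeasurable_normc; have [] := xi1 g.
have mq g : measurable_fun [set: X] (q g).
  by apply: measurable_funM => //; apply: measurable_indic;
    exact: act_preimage_measurable.
have qxi g : {ae mu, forall x, q g x = Normc.normc (xi g x)}.
  have : {ae mu, forall x, ~ (act g @` A) x -> xi g x = 0} := xiA g.
  apply: filterS => x; rewrite act_image /q indicE => xA.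
  have [Ax|/xA ->] := pselect ((act g^-1%g @^-1` A) x).
    by rewrite mem_set// mulr1.
  by rewrite Normc.normc0 mul0r.
have qA g x : q g x != 0 -> A (act g^-1%g x).
  rewrite /q indicE mulf_eq0 => /norP[_]; case: (boolP (x \in _)) => [|_].
    by rewrite inE.
  by rewrite eqxx.
exists q, (fun g x => (omega g^-1%g x)^-1%g); split; split => //.
- by move=> g x; rewrite mulr_ge0 ?normc_ge0// indicE ler0n.
- move=> g; have [_ /L2norm1 <-] := xi1 g.
  apply: ge0_ae_eq_integral => //.
  + by apply/measurable_EFinP/measurable_funX.
  + by apply/measurable_EFinP/measurable_funX.
  + by move=> x _; rewrite lee_fin sqr_ge0.
  + by move=> x _; rewrite lee_fin sqr_ge0.
  + by apply: filterS (qxi g) => x ->.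
- move=> g; apply: (@borel_comp _ _ H H (fun h : H => h^-1%g) (omega g^-1%g));
    first exact: invg_continuous.
  exact: omega_measurable.
- have se0 : 0 < Num.sqrt e by rewrite sqrtr_gt0.
  move=> g h Kgh; have := (L2norm_lt _ _ se0).1 (xiK g h Kgh).
  rewrite sqr_sqrtr; last exact: ltW.
  move/ltW; apply: le_trans.
  apply: ae_ge0_le_integral => //.
  + by move=> x _; rewrite lee_fin sqr_ge0.
  + by apply/measurable_EFinP/measurable_funX/measurable_funB.
  + by move=> x _; rewrite lee_fin sqr_ge0.
  + apply/measurable_EFinP/measurable_funX/cmeasurable_normc/cmeasurableB.
      by have [] := xi1 g.
    by have [] := xi1 h.
  + apply: filterS2 (qxi g) (qxi h) => x -> -> _; rewrite lee_fin.
    rewrite -real_normK ?num_real// lerXn2r ?nnegrE ?normc_ge0//.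
    exact: normc_dist.
- have [L pL LP] := proper_bounded omega_proper cK FA FA.
  exists (closure L); first by rewrite -precompactE.
  move=> g h Kgh; have := ae_act h^-1%g (LP _ Kgh).
  apply: filterS2 (cocycle_quotient g h) => x + Lx gx hx.
  rewrite invgK => ->; apply: subset_closure; apply: Lx; first exact: qA.
  by rewrite -(actionM actP) -mulgA mulgV mulg1; exact: qA.
- move=> L cL; exists (closure [set g : G |
      (0 < mu [set x | [/\ A x, A (act g x) & L (omega g x)]])%E]).
    by rewrite -precompactE; exact: (proper_return omega_proper cL FA FA).
  move=> g h nC.
  have {nC} : ~ (0 < mu [set x | [/\ A x, A (act (g^-1 * h)%g x) & L (omega (g^-1 * h)%g x)]])%E.
    by move=> ?; apply: nC; exact: subset_closure.
  move/negP; rewrite -leNgt measure_le0 => /eqP muS0.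
  have [hH _ _] := lcscH.
  have aeS : {ae mu, forall x, ~ [/\ A x, A (act (g^-1 * h)%g x) & L (omega (g^-1 * h)%g x)]}.
    eexists; split; [|exact: muS0|by move=> x /= /contrapT].
    rewrite (_ : [set x | _] = A `&` (act (g^-1 * h)%g @^-1` A) `&` (omega (g^-1 * h)%g @^-1` L)).
      apply: measurableI; first by apply: measurableI => //;
        exact: act_preimage_measurable.
      rewrite -[X in measurable X]setTI; apply: omega_measurable => //.
      exact: borel_compact.
    by apply/seteqP; split=> [x []|x [[]]].
  apply: filterS2 (cocycle_quotient g h) (ae_act h^-1%g aeS) => x + nS gx hx.
  rewrite invgK => -> Lx; apply: nS; split => //; first exact: qA.
  by rewrite -(actionM actP) -mulgA mulgV mulg1; exact: qA.
Qed.

End core.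

(** * Permanence of coarse embeddability *)

(** A distance function on [H] carrying what a coarse embedding provides; by the
    fifth field, Gaussian functions of it are positive semidefinite. *)
Record hilbert_distance (R : realType) (H : topologicalGroupType)
    (D : H -> H -> R) : Prop := {
  hdist_ge0 : forall s t, 0 <= D s t;
  hdist0 : forall s, D s s = 0;
  hdist_controlled : forall K : set H, compact K -> exists2 r : R, 0 < r &
    forall s t, K (s^-1 * t)%g -> D s t < r;
  hdist_proper : forall r : R, 0 < r -> exists2 L : set H, compact L &
    forall s t, D s t < r -> L (s^-1 * t)%g;
  hdist_gauss : forall a : R, 0 <= a -> psd (fun s t => expR (- (a * D s t ^+ 2)));
  hdist_measurable : forall d (X : measurableType d) (f g : X -> H),
    measurable_fun [set: X] (f : X -> borel H) ->
    measurable_fun [set: X] (g : X -> borel H) ->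
    measurable_fun [set: X] (fun x => D (f x) (g x))
}.

Section coarse_gauss.
Variables (R : realType) (H : topologicalGroupType).
Hypothesis lcscH : lcsc H.
Variables (V : completeNormedModType R[i]) (dot : {dot V for Num.conj}).
Variable u : H -> V.
Hypothesis dotP : norm_of_dot dot.
Hypothesis uc : continuous u.

Definition udist s t : R := complex.Re `|u s - u t|.

Lemma udistE s t : `|u s - u t| = (udist s t)%:C%C.
Proof. by rewrite RRe_real// normr_real. Qed.

Lemma udist_ge0 s t : 0 <= udist s t.
Proof. by rewrite -lecR -udistE normr_ge0. Qed.

Lemma udistC s t : udist s t = udist t s.
Proof. by apply: complexI; rewrite -!udistE distrC. Qed.

Lemma udist_triangle s t w : udist s t <= udist s w + udist w t.
Proof. by rewrite -lecR rmorphD/= -!udistE ler_distD. Qed.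

Lemma udist_near s (e : R) : 0 < e -> \forall t \near s, udist s t < e.
Proof.
move=> e0; have /cvgrPdist_lt := @uc s.
move=> /(_ e%:C%C); rewrite ltcR => /(_ e0).
by apply: filterS => t; rewrite udistE ltcR.
Qed.

Lemma udist_continuous w : continuous (fun s => udist s w).
Proof.
move=> s; apply/cvgrPdist_lt => e e0.
apply: filterS (udist_near s e0) => t; apply: le_lt_trans.
rewrite ler_norml; apply/andP; split.
  by rewrite lerBrDl lerBlDr (udistC s t) addrC; exact: udist_triangle.
by rewrite lerBlDr; exact: udist_triangle.
Qed.

(** [D (f x) (g x) < c] means that some point [w] of a fixed countable dense set
    satisfies [D (f x) w + D w (g x) < c], and for fixed [w] both summands are
    continuous functions of one point. *)
Lemma udist_measurable d (X : measurableType d) (f g : X -> H) :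
  measurable_fun [set: X] (f : X -> borel H) ->
  measurable_fun [set: X] (g : X -> borel H) ->
  measurable_fun [set: X] (fun x => udist (f x) (g x)).
Proof.
move=> mf mg; have [_ _ scH] := lcscH.
have [b bP] := second_countable_enum 1%g scH.
apply: (measurability _ (RGenInftyO.measurableE R)).
move=> _ [_ [c ->] <-]; rewrite setTI.
have -> : (fun x => udist (f x) (g x)) @^-1` [set` `]-oo, c[] =
    \bigcup_n ((fun x => udist (f x) (get (b n)) + udist (g x) (get (b n))) @^-1` [set` `]-oo, c[]).
  apply/seteqP; split=> x /=; rewrite in_itv/=.
    move=> fgc; have e0 : 0 < (c - udist (f x) (g x)) / 2 by rewrite divr_gt0// subr_gt0.
    have [n [_ bx bn]] := bP _ _ (udist_near (f x) e0); exists n => //=.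
    have := bn (get (b n)) (getPex (ex_intro _ _ bx)); rewrite /= in_itv/= => fb.
    have := udist_triangle (g x) (get (b n)) (f x); rewrite (udistC (g x) (f x)).
    by move: fb; lra.
  move=> [n _]; rewrite /= in_itv/=; apply: le_lt_trans.
  by rewrite (udistC (g x)); exact: udist_triangle.
apply: bigcup_measurable => n _; rewrite -[X in measurable X]setTI.
have: measurable_fun [set: X] (fun x => udist (f x) (get (b n)) + udist (g x) (get (b n))).
  apply: measurable_funD.
    exact: (@borel_compR _ _ _ H (fun s => udist s (get (b n))) f (@udist_continuous _)).
  exact: (@borel_compR _ _ _ H (fun s => udist s (get (b n))) g (@udist_continuous _)).
by apply => //; exact: measurable_itv.
Qed.

Lemma Re_dot_psd : psd (fun s t => complex.Re (dot (u s) (u t))).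
Proof.
have dotC v w : dot v w = (dot w v)^*.
  by have := @hermitian_subproof _ _ _ _ dot v w; rewrite expr0 mul1r.
split=> [s t|n x c]; first by rewrite dotC; case: (dot (u t) (u s)).
pose v := \sum_(i < n) (c i)%:C%C *: u (x i).
have : 0 <= complex.Re (dot v v).
  by rewrite -dotP; have : 0 <= `|v| ^+ 2 by []; rewrite lecE => /andP[].
congr (_ <= _); rewrite /v linear_sumlz.
have ReS (F : 'I_n -> R[i]) : complex.Re (\sum_(i < n) F i) = \sum_(i < n) complex.Re (F i).
  by apply: (big_morph (@complex.Re R)) => [[? ?] []|].
rewrite ReS; apply: eq_bigr => i _; rewrite linear_sumr ReS; apply: eq_bigr => j _.
rewrite linearZl_LR linearZr_LR/=.
by case: (dot (u (x i)) (u (x j))) => a b /=; ring.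
Qed.

(** Expanding the square writes the Gaussian as [exp(2 a Re <u_s, u_t>)] weighted by
    a function of [s] and the same function of [t]. *)
Lemma udist_gauss (a : R) : 0 <= a -> psd (fun s t => expR (- (a * udist s t ^+ 2))).
Proof.
move=> a0; pose B s t := complex.Re (dot (u s) (u t)).
have BP : psd B := Re_dot_psd.
have D2 s t : udist s t ^+ 2 = B s s - 2 * B s t + B t t.
  apply: complexI; rewrite rmorphXn/= -udistE dotP.
  have -> : dot (u s - u t) (u s - u t) = (complex.Re (dot (u s - u t) (u s - u t)))%:C%C.
    by rewrite RRe_real// -dotP realX// normr_real.
  congr (_%:C)%C; rewrite linearBl !linearBr/=.
  have -> : B s s - 2 * B s t + B t t = B s s - B s t - (B t s - B t t).
    by rewrite (BP.1 t s); ring.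
  rewrite /B;
    case: (dot (u s) (u s)) (dot (u s) (u t)) (dot (u t) (u s)) (dot (u t) (u t)) => ? ? [? ?] [? ?] [? ?] //=.
have a2 : 0 <= 2 * a by rewrite mulr_ge0.
have := psd_mul_outer (fun s => expR (- (a * B s s))) (psd_expR (psdZ a2 BP)).
congr psd; apply/funext => s; apply/funext => t.
by rewrite D2 -!expRD; congr expR; ring.
Qed.

End coarse_gauss.

Lemma coarsely_embeddable_distance (R : realType) (H : topologicalGroupType) :
  lcsc H -> coarsely_embeddable R H -> exists D : H -> H -> R, hilbert_distance D.
Proof.
move=> lcscH [V [dot [u [dotP uc uK uR]]]]; exists (udist u); split.
- exact: udist_ge0.
- by move=> s; apply: complexI; rewrite -udistE subrr normr0.
- move=> K /uK[r r0 rP]; exists r => // s t /rP.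
  by rewrite udistE ltcR.
- move=> r r0; exists (closure [set k : H | exists g h, k = (g^-1 * h)%g /\
      `|u g - u h| < (r%:C)%C]); first by rewrite -precompactE; exact: uR.
  move=> s t st; apply: subset_closure; exists s, t; split => //.
  by rewrite udistE ltcR.
- by move=> a; exact: udist_gauss.
- by move=> d X f g; exact: udist_measurable.
Qed.

(** Quadratic forms are finite sums, hence commute with the integral. *)
Lemma psd_Rintegral (R : realType) d (X : measurableType d)
    (mu : {measure set X -> \bar R}) (T : Type) (k : X -> T -> T -> R) :
  (forall x, psd (k x)) ->
  (forall s t, mu.-integrable [set: X] (fun x => (k x s t)%:E)) ->
  psd (fun s t => \int[mu]_x k x s t).
Proof.
move=> kP ik; rewrite /Rintegral; split=> [s t|n y c].
  by congr fine; apply: eq_integral => x _; rewrite (kP x).1.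
have : (0 <= \int[mu]_x (quad_form (k x) n y c)%:E)%E.
  by apply: integral_ge0 => x _; rewrite lee_fin; exact: (kP x).2.
have ick i j : mu.-integrable [set: X] (fun x => ((c i * c j)%:E * (k x (y i) (y j))%:E)%E).
  exact: integrableZl.
have -> : (\int[mu]_x (quad_form (k x) n y c)%:E)%E =
    (\int[mu]_x (\sum_(i < n) \sum_(j < n) ((c i * c j)%:E * (k x (y i) (y j))%:E)))%E.
  apply: eq_integral => x _; rewrite /quad_form -sumEFin; apply: eq_bigr => i _.
  by rewrite -sumEFin.
rewrite integral_sum//; last first.
  by move=> i; apply: integrable_sum => // j _; exact: ick.
have -> : (\sum_(i < n) \int[mu]_x \sum_(j < n) ((c i * c j)%:E * (k x (y i) (y j))%:E))%E =
    (quad_form (fun s t => fine (\int[mu]_x (k x s t)%:E)%E) n y c)%:E.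
  rewrite /quad_form -sumEFin; apply: eq_bigr => i _.
  rewrite integral_sum// -sumEFin; apply: eq_bigr => j _.
  by rewrite integralZl// -[X in (_ * X)%E]fineK//; exact: integrable_fin_num.
by rewrite lee_fin.
Qed.

Lemma ae_le_Rintegral (R : realType) d (X : measurableType d)
    (mu : {measure set X -> \bar R}) (f g : X -> R) :
  mu.-integrable [set: X] (EFin \o f) -> mu.-integrable [set: X] (EFin \o g) ->
  (forall x, 0 <= f x) -> (forall x, 0 <= g x) ->
  {ae mu, forall x, f x <= g x} -> \int[mu]_x f x <= \int[mu]_x g x.
Proof.
move=> fi gi f0 g0 fg; rewrite /Rintegral fine_le ?integrable_fin_num//.
apply: ae_ge0_le_integral => //.
- by move=> x _; rewrite lee_fin.
- exact: (measurable_int _ fi).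
- by move=> x _; rewrite lee_fin.
- exact: (measurable_int _ gi).
- by apply: filterS fg => x + _; rewrite lee_fin.
Qed.

Section kernels.
Variables (R : realType) (G H : topologicalGroupType).
Variables (d : measure_display) (X : measurableType d) (mu : probability X R).
Variables (act : G -> X -> X) (omega : G -> X -> H) (F : set (set X)).
Hypothesis lcscG : lcsc G.
Hypothesis lcscH : lcsc H.
Hypothesis actP : nonsingular_action mu act.
Hypothesis omegaP : is_cocycle mu act omega.
Hypothesis Fmeas : F `<=` measurable.
Hypothesis omega_proper : proper_cocycle mu act omega F.
Hypothesis GX_A : pair_property_A mu act F.
Variable D : H -> H -> R.
Hypothesis DP : hilbert_distance D.

(** The kernel is the inner product of [q_g] and [q_h] damped by a Gaussian of the
    distance between [s_g] and [s_h].  Along [K] this distance is bounded, and a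
    flat Gaussian does little damage; off a tube it is so large that the Gaussian
    is at most 1/2 wherever [q_g] and [q_h] are both nonzero. *)
Lemma positive_kernel (K : set G) (e : R) : compact K -> 0 < e -> e <= 1 ->
  exists k : G -> G -> R,
  [/\ psd k, forall g, k g g = 1, forall g h, 0 <= k g h <= 1,
      forall g h, K (g^-1 * h)%g -> 1 - e <= k g h
    & exists2 C : set G, compact C & forall g h, ~ C (g^-1 * h)%g -> k g h <= 2^-1].
Proof.
move=> cK e0 e1.
have e20 : 0 < e / 2 by rewrite divr_gt0.
have [q [s [[mq q0 q1 ms] [qK [L0 cL0 sL0] sC]]]] :=
  proper_cocycle_field lcscH actP omegaP Fmeas omega_proper GX_A cK e20.
have [r r0 rP] := hdist_controlled DP cL0.
(* At distance at most [r] the Gaussian is at least [1 - a r^2 = 1 - e / 2]. *)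
pose a := e / 2 / r ^+ 2.
have a0 : 0 < a by rewrite divr_gt0// exprn_gt0.
pose E g h x : R := expR (- (a * D (s g x) (s h x) ^+ 2)).
have mE g h : measurable_fun [set: X] (E g h).
  apply: measurableT_comp => //; apply: measurable_funN; apply: measurable_funM => //.
  by apply: measurable_funX; exact: (hdist_measurable DP (ms g) (ms h)).
have E01 g h x : 0 < E g h x <= 1.
  have aD : 0 <= a * D (s g x) (s h x) ^+ 2 by rewrite mulr_ge0 ?sqr_ge0// ltW.
  by rewrite expR_gt0 -[leRHS]expR0 ler_expR oppr_le0.
have iq g : mu.-integrable [set: X] (fun x => (q g x ^+ 2)%:E).
  apply/integrableP; split; first by apply/measurable_EFinP/measurable_funX.
  under eq_integral do rewrite gee0_abs ?lee_fin ?sqr_ge0//.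
  by rewrite q1 ltry.
have q1' g : \int[mu]_x (q g x ^+ 2) = 1 by rewrite /Rintegral q1.
have iqq g h (f : X -> R) : measurable_fun [set: X] f -> (forall x, 0 <= f x <= 1) ->
    mu.-integrable [set: X] (fun x => (q g x * q h x * f x)%:E).
  move=> mf f01;
    apply: (@le_integrable _ _ _ mu _ _ _ (fun x => (q g x ^+ 2)%:E + (q h x ^+ 2)%:E)%E) => //.
  - by apply/measurable_EFinP; do 2 apply: measurable_funM => //.
  - move=> x _; have /andP[f0 f1] := f01 x; have := q0 g x; have := q0 h x.
    rewrite -EFinD !abse_EFin lee_fin => h0 g0.
    rewrite !ger0_norm ?addr_ge0 ?mulr_ge0 ?sqr_ge0//.
    apply: (@le_trans _ _ (q g x * q h x)); first by rewrite ler_piMr ?mulr_ge0.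
    by nra.
  - exact: integrableD.
have halfsum g h : \int[mu]_x (2^-1 * (q g x ^+ 2 + q h x ^+ 2)) = 1.
  rewrite RintegralZl//; last exact: (integrableD _ (iq g) (iq h)).
  by rewrite RintegralD ?q1' //; [lra|exact: iq|exact: iq].
have ihalf g h : mu.-integrable [set: X] (EFin \o (fun x => 2^-1 * (q g x ^+ 2 + q h x ^+ 2))).
  exact: (integrableZl measurableT 2^-1 (integrableD measurableT (iq g) (iq h))).
have iqE g h : mu.-integrable [set: X] (EFin \o (fun x => q g x * q h x * E g h x)).
  by apply: iqq => // x; have /andP[/ltW -> ->] := E01 g h x.
exists (fun g h => \int[mu]_x (q g x * q h x * E g h x)); split.
- apply: (@psd_Rintegral _ _ _ mu G (fun x g h => q g x * q h x * E g h x));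
    last exact: iqE.
  move=> x; apply: (psd_mul_outer (fun g => q g x)).
  exact: (psd_pull (fun g => s g x) (hdist_gauss DP (ltW a0))).
- move=> g; rewrite -(q1' g); apply: eq_Rintegral => x _.
  by rewrite /E (hdist0 DP) expr0n/= mulr0 oppr0 expR0 mulr1 expr2.
- move=> g h; apply/andP; split.
    apply: Rintegral_ge0 => x _; have /andP[/ltW E0 _] := E01 g h x.
    by rewrite !mulr_ge0.
  rewrite -(halfsum g h); apply: ae_le_Rintegral => //.
  + by move=> x; have /andP[/ltW E0 _] := E01 g h x; rewrite !mulr_ge0.
  + by move=> x; rewrite mulr_ge0// addr_ge0// sqr_ge0.
  + apply: aeW => x; have /andP[/ltW E0 E1] := E01 g h x.
    apply: (@le_trans _ _ (q g x * q h x)); first by rewrite ler_piMr ?mulr_ge0.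
    have := sqr_ge0 (q g x - q h x); nra.
- move=> g h Kgh.
  have iq1 : mu.-integrable [set: X] (EFin \o (fun x => q g x * q h x)).
    have := iqq g h (cst 1) (measurable_cst _) ltac:(by move=> x; rewrite ler01 lexx).
    by under eq_fun do rewrite mulr1.
  have inner : 1 - e / 4 <= \int[mu]_x (q g x * q h x).
    have : \int[mu]_x ((q g x - q h x) ^+ 2) <= e / 2.
      rewrite /Rintegral -[leRHS]/(fine (e / 2)%:E) fine_le//; last exact: qK.
      rewrite ge0_fin_numE; first exact: le_lt_trans (qK _ _ Kgh) (ltry _).
      by apply: integral_ge0 => x _; rewrite lee_fin sqr_ge0.
    have -> : \int[mu]_x ((q g x - q h x) ^+ 2) =
        \int[mu]_x (2 * (2^-1 * (q g x ^+ 2 + q h x ^+ 2) - q g x * q h x)).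
      by apply: eq_Rintegral => x _; field.
    rewrite RintegralZl//; last exact: (integrableB _ (ihalf g h) iq1).
    rewrite RintegralB// halfsum; lra.
  apply: (@le_trans _ _ (\int[mu]_x ((1 - e / 2) * (q g x * q h x)))).
    rewrite RintegralZl//; nra.
  apply: ae_le_Rintegral => //.
  + exact: (integrableZl measurableT (1 - e / 2) iq1).
  + by move=> x; rewrite !mulr_ge0//; lra.
  + by move=> x; have /andP[/ltW E0 _] := E01 g h x; rewrite !mulr_ge0.
  + apply: filterS (sL0 g h Kgh) => x Lx.
    have [->|g0] := eqVneq (q g x) 0; first by rewrite !mul0r mulr0.
    have [->|h0] := eqVneq (q h x) 0; first by rewrite !(mulr0, mul0r).
    rewrite mulrC ler_wpM2l ?mulr_ge0//.
    apply: le_trans (expR_ge1Dx _); rewrite lerD2l lerN2.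
    have Dr := rP _ _ (Lx g0 h0).
    have -> : e / 2 = a * r ^+ 2 by rewrite /a divfK// expf_neq0// gt_eqF.
    by rewrite ler_wpM2l ?ltW// ltr_pXn2r// ?nnegrE ?(hdist_ge0 DP)// ltW.
(* From the distance [a^(-1/2)] on, the Gaussian is at most [exp(-1) <= 1/2]. *)
- have rho0 : 0 < Num.sqrt a^-1 by rewrite sqrtr_gt0 invr_gt0.
  have [L cL LP] := hdist_proper DP rho0.
  have [C cC CP] := sC L cL; exists C => // g h /CP nL.
  apply: (@le_trans _ _ (\int[mu]_x (2^-1 * (2^-1 * (q g x ^+ 2 + q h x ^+ 2))))).
    apply: ae_le_Rintegral => //.
    + exact: (integrableZl measurableT 2^-1 (ihalf g h)).
    + by move=> x; have /andP[/ltW E0 _] := E01 g h x; rewrite !mulr_ge0.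
    + by move=> x; rewrite !mulr_ge0// addr_ge0// sqr_ge0.
    + apply: filterS nL => x nLx.
      have qq : 0 <= 2^-1 * (2^-1 * (q g x ^+ 2 + q h x ^+ 2)).
        by rewrite !mulr_ge0// addr_ge0// sqr_ge0.
      have [g0|g0] := eqVneq (q g x) 0; first by rewrite [in leLHS]g0 !mul0r.
      have [h0|h0] := eqVneq (q h x) 0; first by rewrite [in leLHS]h0 !(mulr0, mul0r).
      have E2 : E g h x <= 2^-1.
        have rD : Num.sqrt a^-1 <= D (s g x) (s h x).
          by rewrite leNgt; apply/negP => /LP; exact: nLx.
        have aD : 1 <= a * D (s g x) (s h x) ^+ 2.
          rewrite -(@divff _ a) ?gt_eqF// ler_pM2l// -[leLHS]sqr_sqrtr ?invr_ge0 ?(ltW a0)//.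
          by rewrite lerXn2r// nnegrE ?sqrtr_ge0// (hdist_ge0 DP).
        rewrite /E expRN lef_pV2 ?posrE ?expR_gt0//.
        by apply: le_trans (expR_ge1Dx _); rewrite -[leLHS]/(1 + 1) lerD2l.
      apply: (@le_trans _ _ (q g x * q h x * 2^-1)); first by rewrite ler_wpM2l ?mulr_ge0.
      have := sqr_ge0 (q g x - q h x); nra.
  by rewrite RintegralZl// halfsum mulr1.
Qed.

End kernels.

Section negative_type.
Variables (R : realType) (G : topologicalGroupType).
Hypothesis lcscG : lcsc G.

(** Summing [1 - k_n] for kernels [k_n] within [2^-n] of 1 on the n-th set of a
    compact exhaustion: the sum is finite on tubes, and every kernel below 1/2
    contributes at least 1/2. *)
Lemma negative_type_of_kernels :
  (forall (K : set G) (e : R), compact K -> 0 < e -> e <= 1 ->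
    exists k : G -> G -> R,
    [/\ psd k, forall g, k g g = 1, forall g h, 0 <= k g h <= 1,
        forall g h, K (g^-1 * h)%g -> 1 - e <= k g h
      & exists2 C : set G, compact C &
          forall g h, ~ C (g^-1 * h)%g -> k g h <= 2^-1]) ->
  exists N : G -> G -> R,
  [/\ forall g, N g g = 0, forall g h, N g h = N h g,
      forall o, psd (fun g h => N g o + N o h - N g h),
      forall K : set G, compact K -> exists r : R,
        forall g h, K (g^-1 * h)%g -> N g h <= r
    & forall r : R, exists2 C : set G, compact C &
        forall g h, N g h <= r -> C (g^-1 * h)%g].
Proof.
move=> kernels; have [V [p [phi phiP]]] := lcsc_unity R lcscG.
(* An exhaustion of [G] by compact sets that absorbs every compact set. *)
pose K n : set G := \big[setU/set0]_(i < n) [set (p i * v)%g | v in V].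
have KP n i g : (i < n)%N -> V ((p i)^-1 * g)%g -> K n g.
  move=> iN Vg; rewrite /K -(bigcup_mkord _ (fun i => [set (p i * v)%g | v in V]));
    exists i => //.
  by exists ((p i)^-1 * g)%g => //; rewrite mulVKg.
have cK n : compact (K n).
  by apply: bigsetU_compact => i _; exact: translate_compact (unity_compact phiP).
have K_le n m : (n <= m)%N -> K n `<=` K m.
  move=> nm g;
    rewrite /K -!(bigcup_mkord _ (fun i => [set (p i * v)%g | v in V])) => -[i /= iN Kg].
  by exists i => //=; exact: leq_trans nm.
have half0 n : 0 < 2^-1 ^+ n :> R by rewrite exprn_gt0.
have half1 n : 2^-1 ^+ n <= 1 :> R by rewrite exprn_ile1// invf_le1// ler1n.
have /choice[k kP] := fun n => kernels (K n) _ (cK n) (half0 n) (half1 n).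
pose t g h n : R := 1 - k n g h.
have t0 g h n : 0 <= t g h n.
  by have [_ _ /(_ g h)/andP[_ k1] _ _] := kP n; rewrite subr_ge0.
have t1 g h n : t g h n <= 1.
  by have [_ _ /(_ g h)/andP[k0 _] _ _] := kP n; rewrite lerBlDr lerDl.
have S_nd g h : nondecreasing_seq (series (t g h)).
  by apply: nondecreasing_series => n _ _; exact: t0.
have S_le g h n m : K n (g^-1 * h)%g -> series (t g h) m <= n%:R + 2.
  move=> Kn; rewrite seriesEord/=.
  apply: (@le_trans _ _ (\sum_(i < m) ((i < n)%:R + 2^-1 ^+ i))).
    apply: ler_sum => i _; have [im|ni] := ltnP i n.
      by apply: le_trans (t1 g h i) _; rewrite lerDl ltW.
    rewrite add0r; have [_ _ _ /(_ g h) + _] := kP i.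
    by move=> /(_ (K_le _ _ ni _ Kn)); rewrite /t; lra.
  rewrite big_split/= lerD//.
    elim: m => [|m IH]; first by rewrite big_ord0 ler0n.
    have [mn|nm] := ltnP m n.
      apply: (@le_trans _ _ m.+1%:R); last by rewrite ler_nat.
      rewrite -[m.+1 in leRHS]card_ord -sum1_card natr_sum; apply: ler_sum => i _.
      by rewrite lern1 leq_b1.
    by rewrite big_ord_recr/= ltnNge nm addr0.
  suff -> : \sum_(i < m) 2^-1 ^+ i = 2 - 2 * 2^-1 ^+ m :> R.
    by rewrite gerBl mulr_ge0// ltW.
  elim: m => [|m IH]; first by rewrite big_ord0 expr0 mulr1 subrr.
  by rewrite big_ord_recr/= IH exprS; field.
have S_K g h : exists n, K n (g^-1 * h)%g.
  by have [i Vi] := unity_cover phiP (g^-1 * h)%g; exists i.+1; exact: KP Vi.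
have S_cvg g h : series (t g h) @ \oo --> limn (series (t g h)).
  have [n Kn] := S_K g h.
  apply: (nondecreasing_is_cvgn (S_nd g h)).
  by exists (n%:R + 2) => _ [m _ <-]; exact: S_le.
exists (fun g h => limn (series (t g h))); split.
- move=> g; apply: (@cvg_lim R^o) => //.
  have -> : series (t g g) = cst 0; last exact: cvg_cst.
  apply/funext => n; rewrite seriesEord/= big1// => i _.
  by have [_ kg _ _ _] := kP i; rewrite /t kg subrr.
- move=> g h; suff -> : t g h = t h g by [].
  by apply/funext => n; have [[kC _] _ _ _ _] := kP n; rewrite /t kC.
- move=> o; apply: (@psd_lim _ _ (fun n g h => \sum_(m < n) (k m g h - k m g o - k m o h + k m o o))).
    move=> n; apply: (@psd_sum _ _ (fun m g h => k m g h - k m g o - k m o h + k m o o)) => m.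
    by apply: psd_rebase; have [] := kP m.
  move=> g h.
  have -> : (fun n => \sum_(m < n) (k m g h - k m g o - k m o h + k m o o)) =
      (fun n => series (t g o) n + series (t o h) n - series (t g h) n).
    apply/funext => n; rewrite !seriesEord/= -big_split -sumrB.
    apply: eq_bigr => m _; have [_ kk _ _ _] := kP m; rewrite (kk o) /t/=; ring.
  by apply: cvgB; [apply: cvgD|]; exact: S_cvg.
- move=> K' cK'; have [n nP] := compact_sub_cover phiP cK'.
  exists (n%:R + 2) => g h /nP[i iN Vi].
  apply: limr_le; first by apply/cvg_ex; eexists; exact: S_cvg.
  by apply: nearW => m; apply: S_le; exact: KP Vi.
- move=> r; have /choice[C CP] : forall n, exists C : set G, compact C /\
      forall g h, ~ C (g^-1 * h)%g -> k n g h <= 2^-1.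
    by move=> n; have [_ _ _ _ [C cC CP]] := kP n; exists C.
  (* Outside the first [n] tubes the sum is at least [n / 2], which exceeds [r]. *)
  pose n := (Num.truncn (2 * `|r|)).+1.
  have nr : 2 * r < n%:R.
    by apply: le_lt_trans (truncnS_gt _); rewrite ler_wpM2l// ler_norm.
  exists (\big[setU/set0]_(i < n) C i).
    by apply: bigsetU_compact => i _; have [] := CP i.
  move=> g h Nr; apply: contrapT; rewrite -bigcup_mkord => nC.
  have : series (t g h) n <= r.
    by apply: le_trans Nr; exact: (nondecreasing_cvgn_le (S_nd g h)).
  rewrite leNgt => /negP; apply; apply: (@lt_le_trans _ _ (n%:R * 2^-1)).
    by rewrite ltr_pdivlMr// mulrC.
  rewrite seriesEord/= -[n in leLHS]card_ord -sum1_card natr_sum mulr_suml.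
  apply: ler_sum => i _; rewrite mul1r /t.
  have : k i g h <= 2^-1.
    by have [_] := CP i; apply => Ci; apply: nC; exists i => //=.
  by lra.
Qed.

End negative_type.

Section l2_finite.
Variable R : realType.

Lemma l2_seminorm_stable n m (f : nat -> R[i]) :
  (forall i, (n <= i)%N -> f i = 0) -> (n <= m)%N ->
  l2_seminorm m f = l2_seminorm n f.
Proof.
move=> f0 nm; congr Num.sqrt; 
  apply: (sum_ord_widen (f := fun i => Normc.normc (f i) ^+ 2) nm) => i ni.
by rewrite f0// Normc.normc0 expr0n.
Qed.

Lemma l2_finite_subproof n (f : nat -> R[i]) :
  (forall i, (n <= i)%N -> f i = 0) -> f \in @l2_pred R.
Proof.
move=> f0; apply/l2_predP; exists (l2_seminorm n f) => m.
have [nm|/ltnW mn] := leqP n m; first by rewrite (l2_seminorm_stable f0).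
exact: l2_seminorm_le.
Qed.

Lemma l2_norm_finite n (u : l2 R) : (forall i, (n <= i)%N -> u i = 0) ->
  l2_norm u = l2_seminorm n u.
Proof.
move=> u0; apply/eqP; rewrite eq_le l2_seminorm_le_norm andbT.
apply: l2_norm_le => m.
have [nm|/ltnW mn] := leqP n m; first by rewrite (l2_seminorm_stable u0).
exact: l2_seminorm_le.
Qed.

(** Schoenberg's correspondence: with the point 0 placed at the origin, the kernel
    determines all inner products, and the Cholesky algorithm realizes them. *)
Lemma negative_type_embedding (N : nat -> nat -> R) :
  (forall i, N i i = 0) -> (forall i j, N i j = N j i) ->
  psd (fun i j => N i 0%N + N 0%N j - N i j) ->
  exists v : nat -> l2 R, forall i j, `|v i - v j| ^+ 2 = (2 * N i j)%:C%C.
Proof.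
set M := (fun i j => _) => N0 NC MP.
pose f i m : R[i] := (cholesky M i m)%:C%C.
have f0 i m : (i < m)%N -> f i m = 0 by move=> im; rewrite /f cholesky0.
have f0' i : forall m, (i.+1 <= m)%N -> f i m = 0 by move=> m; exact: f0.
exists (fun i => L2Seq (l2_finite_subproof (f0' i))) => i j.
rewrite l2_normE -rmorphXn/=; congr (_%:C)%C.
pose n := (maxn i j).+1.
have ni : (i < n)%N by rewrite ltnS leq_maxl.
have nj : (j < n)%N by rewrite ltnS leq_maxr.
rewrite (@l2_norm_finite n) => [|m nm]; last first.
  by rewrite l2D l2N /= !f0 ?subrr//; [exact: leq_trans nj nm|exact: leq_trans ni nm].
rewrite l2_seminorm_sqr.
transitivity (M i i + M j j - 2 * M i j); last first.
  by rewrite /M !N0 (NC i 0%N) (NC j 0%N); lra.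
rewrite !(psd_cholesky (n := n) _ MP)// mulr_sumr -big_split -sumrB.
apply: eq_bigr => m _.
transitivity ((cholesky M i m - cholesky M j m) ^+ 2); last by rewrite /=; ring.
have nC (a b : R) : Normc.normc (a%:C%C - b%:C%C) ^+ 2 = (a - b) ^+ 2.
  by rewrite -rmorphB/= expr0n/= addr0 sqrtr_sqr real_normK ?num_real.
exact: nC.
Qed.

End l2_finite.

Lemma real_complex_continuous (R : realType) (T : topologicalType) (f : T -> R) :
  continuous f -> continuous (fun t => (f t)%:C%C : (R[i] : numFieldType)).
Proof.
move=> fc t; apply/cvgrPdist_lt => e; rewrite ltcE => /andP[/eqP ei e0].
have -> : e = (complex.Re e)%:C%C by case: (e) ei => a b /= ->.
have /cvgrPdist_lt := fc t; move=> /(_ _ e0); apply: filterS => x.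
by rewrite -rmorphB/= normc_def/= expr0n/= addr0 sqrtr_sqr ltcR.
Qed.

Section averaging.
Variables (R : realType) (G : topologicalGroupType).
Variables (W : set G) (p : nat -> G) (phi : nat -> G -> R).
Hypothesis phiP : unity W p phi.
Variables (V : normedModType R[i]) (v : nat -> V).

Definition unity_avg (n : nat) g : V := \sum_(i < n) (phi i g)%:C%C *: v i.

Lemma unity_avg_continuous : exists2 u : G -> V, continuous u &
  forall g, exists n, \sum_(i < n) phi i g = 1 /\ u g = unity_avg n g.
Proof.
have /choice[n nP] := unity_at phiP.
have uE g m : (forall i, (m <= i)%N -> phi i g = 0) -> unity_avg (n g) g = unity_avg m g.
  move=> m0; have [_ n0] := nP g.
  by apply: (sum_ord_cutoff (f := fun i => (phi i g)%:C%C *: v i)) => i ?;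
    [rewrite n0// scale0r|rewrite m0// scale0r].
exists (fun g => unity_avg (n g) g); last by move=> g; exists (n g); have [] := nP g.
move=> g; have [m mP] := unity_near phiP g.
have [_ m0] := nbhs_singleton mP.
suff : unity_avg (n x) x @[x --> g] --> unity_avg (n g) g by [].
rewrite (uE g m m0).
have : unity_avg m x @[x --> g] --> unity_avg m g.
  apply: cvg_sumr => i; apply: cvgZr_tmp.
  exact: (real_complex_continuous (unity_continuous phiP (i := i))).
apply: cvg_trans; apply: near_eq_cvg; apply: filterS mP => h [_ h0].
by rewrite (uE h m h0).
Qed.

Lemma unity_avg_dist g n z (r : R) : \sum_(i < n) phi i g = 1 ->
  (forall i, phi i g != 0 -> `|v i - z| <= r%:C%C) ->
  `|unity_avg n g - z| <= r%:C%C.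
Proof.
move=> s1 vz.
have -> : unity_avg n g - z = \sum_(i < n) (phi i g)%:C%C *: (v i - z).
  under [RHS]eq_bigr do rewrite scalerBr.
  by rewrite sumrB -scaler_suml -rmorph_sum/= s1 scale1r.
apply: (le_trans (ler_norm_sum _ _ _)).
apply: (@le_trans _ _ (\sum_(i < n) (phi i g)%:C%C * r%:C%C)).
  apply: ler_sum => i _; rewrite normrZ normc_def/= expr0n/= addr0 sqrtr_sqr.
  rewrite ger0_norm ?(unity_ge0 phiP)//.
  have [->|/vz] := eqVneq (phi i g) 0; first by rewrite !mul0r.
  by move=> le; rewrite ler_wpM2l// ler0c (unity_ge0 phiP).
by rewrite -mulr_suml -rmorph_sum/= s1 mul1r.
Qed.

End averaging.

(** Replacing [v_i] by its average moves points by a bounded amount only, because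
    the [v_i] that are averaged at [g] come from points of the tube of [W] around
    [g]; this makes the embedding continuous and keeps it coarse. *)
Lemma unity_avg_coarse (R : realType) (G : topologicalGroupType)
    (W : set G) (p : nat -> G) (phi : nat -> G -> R)
    (V : normedModType R[i]) (v : nat -> V) (N : G -> G -> R) :
  hausdorff_space G -> unity W p phi ->
  (forall i j, `|v i - v j| ^+ 2 = (2 * N (p i) (p j))%:C%C) ->
  (forall K : set G, compact K -> exists r : R,
    forall g h, K (g^-1 * h)%g -> N g h <= r) ->
  (forall r : R, exists2 C : set G, compact C &
    forall g h, N g h <= r -> C (g^-1 * h)%g) ->
  exists u : G -> V,
    [/\ continuous u,
        forall K : set G, compact K -> exists2 r : R, 0 < r &
          forall g h, K (g^-1 * h)%g -> `|u g - u h| < r%:C%C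
      & forall r : R, 0 < r -> precompact
          [set k : G | exists g h, k = (g^-1 * h)%g /\ `|u g - u h| < r%:C%C]].
Proof.
move=> hG phiP vE NK NC; have cW := unity_compact phiP.
have [u uc uP] := unity_avg_continuous phiP v.
have v_le (K : set G) : compact K -> exists2 r : R, 0 <= r & forall i j,
    K ((p i)^-1 * p j)%g -> `|v i - v j| <= r%:C%C.
  move=> /NK[r rP]; exists (Num.sqrt (2 * r)); first exact: sqrtr_ge0.
  move=> i j /rP Nr; rewrite -(@ler_pXn2r _ 2) ?nnegrE ?ler0c ?sqrtr_ge0 ?normr_ge0//.
  rewrite vE -rmorphXn/= lecR; have [r0|r0] := leP 0 (2 * r).
    by rewrite sqr_sqrtr// ler_wpM2l.
  by rewrite ltr0_sqrtr// expr0n/=; lra.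
exists u; split => //.
- move=> K cK.
  have [r r0 rP] := v_le _ (mulset_compact (mulset_compact cW cK) (invset_compact cW)).
  exists (r + 1); first by rewrite ltr_wpDl.
  move=> g h Kgh; apply: (@le_lt_trans _ _ r%:C%C); last by rewrite ltcR ltrDl.
  have [n [sn ->]] := uP g; apply: (unity_avg_dist phiP sn) => i /(unity_supp phiP) Wi.
  rewrite distrC.
  have [m [sm ->]] := uP h; apply: (unity_avg_dist phiP sm) => j /(unity_supp phiP) Wj.
  rewrite distrC; apply: rP; exists ((p i)^-1 * g * (g^-1 * h))%g.
    by exists ((p i)^-1 * g)%g => //; exists (g^-1 * h)%g.
  exists ((p j)^-1 * h)^-1%g; first by exists ((p j)^-1 * h)%g.
  by rewrite invgM invgK -!mulgA mulVKg mulVKg.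
- move=> r r0.
  have [b b0 bP] := v_le _ (mulset_compact cW (invset_compact cW)).
  have uv g i : phi i g != 0 -> `|u g - v i| <= b%:C%C.
    move=> /(unity_supp phiP) Wi.
    have [n [sn ->]] := uP g; apply: (unity_avg_dist phiP sn) => j /(unity_supp phiP) Wj.
    apply: bP; exists ((p j)^-1 * g)%g => //.
    exists ((p i)^-1 * g)^-1%g; first by exists ((p i)^-1 * g)%g.
    by rewrite invgM invgK -!mulgA mulVKg.
  have [C cC CP] := NC ((r + b + b) ^+ 2 / 2).
  have cWCW := mulset_compact (mulset_compact (invset_compact cW) cC) cW.
  apply: precompact_subset (compact_precompact hG cWCW) => _ [g [h [-> ugh]]].
  have [i gi] := unity_pick phiP g; have [j hj] := unity_pick phiP h.
  exists (((p i)^-1 * g)^-1 * ((p i)^-1 * p j))%g.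
    exists ((p i)^-1 * g)^-1%g; first by exists ((p i)^-1 * g)%g => //;
      exact: (unity_supp phiP gi).
    exists ((p i)^-1 * p j)%g => //; apply: CP.
    rewrite ler_pdivlMr// mulrC -lecR -vE rmorphXn/= lerXn2r ?nnegrE ?ler0c
      ?normr_ge0 ?addr_ge0 ?(ltW r0)//.
    rewrite !rmorphD/=.
    have -> : v i - v j = (u g - u h) - (u g - v i) + (u h - v j).
      by rewrite opprB (addrC (u g - u h)) !subrKA.
    apply: (le_trans (ler_normD _ _)); rewrite lerD ?uv//.
    by apply: (le_trans (ler_normB _ _)); rewrite lerD ?uv// ltW.
  exists ((p j)^-1 * h)%g; first exact: (unity_supp phiP hj).
  by rewrite invgM invgK -!mulgA mulVKg mulVKg.
Qed.

Lemma coarsely_embeddable_of_negative_type (R : realType) (G : topologicalGroupType)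
    (N : G -> G -> R) : lcsc G ->
  (forall g, N g g = 0) -> (forall g h, N g h = N h g) ->
  (forall o, psd (fun g h => N g o + N o h - N g h)) ->
  (forall K : set G, compact K -> exists r : R,
    forall g h, K (g^-1 * h)%g -> N g h <= r) ->
  (forall r : R, exists2 C : set G, compact C &
    forall g h, N g h <= r -> C (g^-1 * h)%g) ->
  coarsely_embeddable R G.
Proof.
move=> lcscG N0 Nsym NP NK NC; have [hG _ _] := lcscG.
have [W [p [phi phiP]]] := lcsc_unity R lcscG.
have [v vE] := @negative_type_embedding R (fun i j => N (p i) (p j))
  (fun i => N0 (p i)) (fun i j => Nsym (p i) (p j)) (psd_pull p (NP (p 0%N))).
have [u [uc uK uR]] := unity_avg_coarse hG phiP vE NK NC.
by exists (l2 R), (@l2_dot R), u; split => //; exact: l2_norm_of_dot.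
Qed.

Lemma coarsely_embeddable_of_cocycle (R : realType) (G H : topologicalGroupType)
    (d : measure_display) (X : measurableType d) (mu : probability X R)
    (act : G -> X -> X) (omega : G -> X -> H) (F : set (set X)) :
  lcsc G -> lcsc H -> nonsingular_action mu act -> is_cocycle mu act omega ->
  F `<=` measurable -> proper_cocycle mu act omega F ->
  pair_property_A mu act F ->
  coarsely_embeddable R H -> coarsely_embeddable R G.
Proof.
move=> lcscG lcscH actP omegaP Fmeas omega_proper GX_A.
move=> /(coarsely_embeddable_distance lcscH)[D DP].
have [N [N0 Nsym NP NK NC]] := negative_type_of_kernels lcscG
  (positive_kernel lcscH actP omegaP Fmeas omega_proper GX_A DP).
exact: coarsely_embeddable_of_negative_type N0 Nsym NP NK NC.
Qed.

(** * Permanence of property A *)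

Section L1.
Variables (R : realType) (d : measure_display) (X : measurableType d).
Variable mu : {measure set X -> \bar R}.

Lemma fine_dist_le (A B C : \bar R) : A \is a fin_num -> B \is a fin_num ->
  (A <= B + C)%E -> (B <= A + C)%E -> (`|fine A - fine B|%:E <= C)%E.
Proof.
case: A B C => [a||] [b||] [c||]//= _ _; rewrite ?leey// -?EFinD !lee_fin.
by move=> ab ba; rewrite ler_distl; apply/andP; split; lra.
Qed.

Lemma ge0_integral_leD (D : set X) (f g : X -> R) : measurable D ->
  measurable_fun [set: X] f -> measurable_fun [set: X] g ->
  (forall x, 0 <= f x) -> (forall x, 0 <= g x) ->
  (\int[mu]_(x in D) (f x)%:E <=
   \int[mu]_(x in D) (g x)%:E + \int[mu]_(x in D) `|f x - g x|%:E)%E.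
Proof.
move=> mD mf mg f0 g0.
have mabs : measurable_fun [set: X] (fun x => `|f x - g x|).
  by apply: measurableT_comp => //; exact: measurable_funB.
rewrite -ge0_integralD//; first last.
- by apply/measurable_EFinP; exact: measurable_funTS.
- by apply/measurable_EFinP; exact: measurable_funTS.
- by move=> x _; rewrite lee_fin.
apply: ge0_le_integral => //.
- by move=> x _; rewrite lee_fin.
- by apply/measurable_EFinP; exact: measurable_funTS.
- by apply: emeasurable_funD; apply/measurable_EFinP; exact: measurable_funTS.
- move=> x _; rewrite -EFinD lee_fin -lerBlDl; exact: ler_norm.
Qed.

Lemma ge0_integral_dist (D : set X) (f g : X -> R) : measurable D ->
  measurable_fun [set: X] f -> measurable_fun [set: X] g ->
  (forall x, 0 <= f x) -> (forall x, 0 <= g x) ->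
  (\int[mu]_(x in D) (f x)%:E < +oo)%E -> (\int[mu]_(x in D) (g x)%:E < +oo)%E ->
  (`|fine (\int[mu]_(x in D) (f x)%:E) - fine (\int[mu]_(x in D) (g x)%:E)|%:E
    <= \int[mu]_(x in D) `|f x - g x|%:E)%E.
Proof.
move=> mD mf mg f0 g0 fi gi; apply: fine_dist_le.
- by rewrite ge0_fin_numE//; apply: integral_ge0 => x _; rewrite lee_fin.
- by rewrite ge0_fin_numE//; apply: integral_ge0 => x _; rewrite lee_fin.
- exact: ge0_integral_leD.
- under [X in (_ <= _ + X)%E]eq_integral do rewrite distrC.
  exact: ge0_integral_leD.
Qed.

Lemma weighted_amgm (t u v : R) : 0 < t ->
  u * v <= (2 * t)^-1 * u ^+ 2 + t * (u ^+ 2 + v ^+ 2) / 2.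
Proof.
move=> t0; have tn0 : t != 0 by rewrite gt_eqF.
have -> : (2 * t)^-1 * u ^+ 2 + t * (u ^+ 2 + v ^+ 2) / 2 =
    u * v + ((u - t * v) ^+ 2 + t ^+ 2 * u ^+ 2) / (2 * t) by field.
rewrite lerDl; apply: divr_ge0; last by rewrite mulr_ge0// ltW.
by apply: addr_ge0; [exact: sqr_ge0|apply: mulr_ge0; exact: sqr_ge0].
Qed.

(** By the weighted arithmetic-geometric mean inequality
    [|x^2 - y^2| <= (x - y)^2 / (2 t) + t (x^2 + y^2)]. *)
Lemma integral_dist_sqr (x y : X -> R) (t : R) : 0 < t ->
  measurable_fun [set: X] x -> measurable_fun [set: X] y ->
  (\int[mu]_z (x z ^+ 2)%:E = 1)%E -> (\int[mu]_z (y z ^+ 2)%:E = 1)%E ->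
  (\int[mu]_z ((x z - y z) ^+ 2)%:E <= (t ^+ 2)%:E)%E ->
  (\int[mu]_z `|x z ^+ 2 - y z ^+ 2|%:E <= (3 * t)%:E)%E.
Proof.
move=> t0 mx my x1 y1 xy; have tn0 : t != 0 by rewrite gt_eqF.
have mX (f : X -> R) : measurable_fun [set: X] f ->
    measurable_fun [set: X] (fun z => (f z ^+ 2)%:E).
  by move=> mf; apply/measurable_EFinP/measurable_funX.
have mXY := mX _ (measurable_funB mx my).
apply: (@le_trans _ _ (\int[mu]_z ((2 * t)^-1%:E * ((x z - y z) ^+ 2)%:E +
    t%:E * ((x z ^+ 2)%:E + (y z ^+ 2)%:E)))%E).
  apply: ge0_le_integral => //.
  - apply/measurable_EFinP; apply: measurableT_comp => //.
    by apply: measurable_funB; exact: measurable_funX.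
  - apply: emeasurable_funD; first exact: measurable_funeM.
    by apply: measurable_funeM; apply: emeasurable_funD; exact: mX.
  - move=> z _; rewrite -[leRHS]/((2 * t)^-1 * (x z - y z) ^+ 2 +
      t * (x z ^+ 2 + y z ^+ 2))%:E lee_fin subr_sqr normrM.
    set a := x z; set b := y z; set s := a - b; set p := a + b.
    have -> : t * (a ^+ 2 + b ^+ 2) = t * (`|s| ^+ 2 + `|p| ^+ 2) / 2.
      by rewrite !real_normK ?num_real// /s /p; field.
    rewrite -(real_normK (num_real s)); exact: weighted_amgm.
rewrite ge0_integralD//; first last.
- by apply: measurable_funeM; apply: emeasurable_funD; exact: mX.
- by move=> z _; rewrite mule_ge0 ?adde_ge0 ?lee_fin ?sqr_ge0// ltW.
- exact: measurable_funeM.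
- by move=> z _; rewrite mule_ge0 ?lee_fin ?sqr_ge0// invr_ge0 mulr_ge0// ltW.
rewrite ge0_integralZl_EFin//; first last.
- by rewrite invr_ge0 mulr_ge0// ltW.
- by move=> z _; rewrite lee_fin sqr_ge0.
rewrite ge0_integralZl_EFin//; first last.
- exact: ltW.
- by apply: emeasurable_funD; exact: mX.
- by move=> z _; rewrite adde_ge0 ?lee_fin ?sqr_ge0.
rewrite ge0_integralD//; first last.
- exact: mX.
- by move=> z _; rewrite lee_fin sqr_ge0.
- exact: mX.
- by move=> z _; rewrite lee_fin sqr_ge0.
rewrite x1 y1; apply: (@le_trans _ _ ((2 * t)^-1%:E * (t ^+ 2)%:E + t%:E * (1 + 1))%E).
  by rewrite leeD2r// lee_wpmul2l// lee_fin invr_ge0 mulr_ge0// ltW.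
rewrite -[leLHS]/((2 * t)^-1 * t ^+ 2 + t * (1 + 1))%:E lee_fin.
have -> : (2 * t)^-1 * t ^+ 2 = t / 2 by field.
lra.
Qed.

End L1.

Lemma unity_nneseries (R : realType) (G : topologicalGroupType) (V : set G)
    (p : nat -> G) (phi : nat -> G -> R) (g : G) (c : R) : unity V p phi ->
  0 <= c -> (\sum_(i <oo) (phi i g * c)%:E = c%:E)%E.
Proof.
move=> phiP c0; have [n [sn n0]] := unity_at phiP g.
rewrite (nneseries_split 0 n); last first.
  by move=> i _; rewrite lee_fin mulr_ge0// (unity_ge0 phiP).
rewrite add0n eseries0 ?adde0; last by move=> i ni _; rewrite n0// mul0r.
by rewrite big_mkord sumEFin -mulr_suml sn mul1r.
Qed.

(** The countable, L^1 form of property A: probability weights [b s] on the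
    points [r j] that concentrate near [s] and vary slowly with [s]. *)
Record reiter (R : realType) (G : topologicalGroupType) (K : set G) (e : R)
    (b : G -> nat -> R) (r : nat -> G) (L : set G) : Prop := {
  reiter_ge0 : forall s j, 0 <= b s j;
  reiter_sum : forall s, (\sum_(j <oo) (b s j)%:E = 1)%E;
  reiter_small : forall s t, K (s^-1 * t)%g ->
    (\sum_(j <oo) `|b s j - b t j|%:E <= e%:E)%E;
  reiter_compact : compact L;
  reiter_supp : forall s j, b s j != 0 -> L (s^-1 * r j)%g
}.

Section reiter_of_property_A.
Variables (R : realType) (H : topologicalGroupType).
Variable mu : {measure set (borel H) -> \bar R}.
Hypothesis lcscH : lcsc H.
Hypothesis HA : group_property_A mu.

Lemma L2unit_dist (f g : borel H -> R[i]) (t : R) : 0 < t ->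
  L2unit mu f -> L2unit mu g -> (L2norm mu (f \- g)%R < t%:E)%E ->
  (\int[mu]_z `|Normc.normc (f z) ^+ 2 - Normc.normc (g z) ^+ 2|%:E <= (3 * t)%:E)%E.
Proof.
move=> t0 [mf f1] [mg g1] fg.
have mnf := cmeasurable_normc mf; have mng := cmeasurable_normc mg.
apply: integral_dist_sqr => //; [exact/L2norm1|exact/L2norm1|].
apply: le_trans (ltW ((L2norm_lt mu (f \- g)%R t0).1 fg)).
apply: ge0_le_integral => //.
- by move=> z _; rewrite lee_fin sqr_ge0.
- by apply/measurable_EFinP/measurable_funX/measurable_funB.
- by apply/measurable_EFinP/measurable_funX/cmeasurable_normc/cmeasurableB.
- move=> z _; rewrite lee_fin -real_normK ?num_real// lerXn2r ?nnegrE ?normc_ge0//.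
  exact: normc_dist.
Qed.

(** The weight of [s] at [j] is the mass of [|eta_s|^2] seen by the j-th function
    of a partition of unity. *)
Lemma reiter_of_property_A (K : set H) (e : R) : compact K -> 0 < e ->
  exists b r L, reiter K e b r L /\ forall j, continuous (fun s => b s j).
Proof.
move=> cK e0; have e30 : 0 < e / 3 by rewrite divr_gt0.
have [eta [eta1 etac etaK [L cL etaL]]] := HA cK e30.
have [V [p [phi phiP]]] := lcsc_unity R lcscH.
pose a s t := Normc.normc (eta s t) ^+ 2.
have ma s : measurable_fun [set: borel H] (a s).
  by apply/measurable_funX/cmeasurable_normc; have [] := eta1 s.
have a0 s t : 0 <= a s t by exact: sqr_ge0.
have a1 s : (\int[mu]_t (a s t)%:E = 1)%E by have [_ /L2norm1] := eta1 s.
have mphi i : measurable_fun [set: borel H] (phi i).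
  have := @borel_compR R _ (borel H) H (phi i) idfun (unity_continuous phiP (i := i)).
  by apply; exact: measurable_id.
have phi0 := unity_ge0 phiP.
have sum_phi t c : 0 <= c -> (\sum_(i <oo) (phi i t * c)%:E = c%:E)%E.
  by move=> c0; exact: unity_nneseries phiP c0.
have mpa j s : measurable_fun [set: borel H] (fun t => phi j t * a s t).
  exact: measurable_funM.
have pa0 j s t : 0 <= phi j t * a s t by rewrite mulr_ge0.
have sum_int (f : borel H -> R) : measurable_fun [set: borel H] f -> (forall t, 0 <= f t) ->
    (\sum_(j <oo) \int[mu]_t (phi j t * f t)%:E = \int[mu]_t (f t)%:E)%E.
  move=> mf f0; rewrite -integral_nneseries//.
  - by apply: eq_integral => t _; exact: sum_phi.
  - by move=> j; apply/measurable_EFinP; exact: measurable_funM.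
  - by move=> j t _; rewrite lee_fin mulr_ge0.
pose I j s := (\int[mu]_t (phi j t * a s t)%:E)%E.
have I0 j s : (0 <= I j s)%E by apply: integral_ge0 => t _; rewrite lee_fin.
have I1 j s : (I j s <= 1)%E.
  rewrite -(a1 s) -(sum_int (a s))//.
  apply: le_trans (nneseries_lim_ge j.+1 _); last by move=> i _ _; exact: I0.
  by rewrite big_nat_recr//= leeDr//; apply: sume_ge0 => i _; exact: I0.
have Ifin j s : (I j s < +oo)%E by apply: le_lt_trans (I1 j s) (ltry _).
pose b s j := fine (I j s).
have bE s j : (b s j)%:E = I j s by rewrite fineK// ge0_fin_numE.
have mabs s t : measurable_fun [set: borel H] (fun x => `|a s x - a t x|).
  by apply: measurableT_comp => //; exact: measurable_funB.
have b_dist s t j : (`|b s j - b t j|%:E <= \int[mu]_x (phi j x * `|a s x - a t x|)%:E)%E.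
  rewrite (eq_integral (fun x : borel H => `|phi j x * a s x - phi j x * a t x|%:E)).
    by apply: ge0_integral_dist => //; exact: Ifin.
  by move=> x _; rewrite -mulrBr normrM ger0_norm.
have a_dist s t (c : R) : 0 < c -> (L2norm mu (eta s \- eta t)%R < c%:E)%E ->
    (\int[mu]_x `|a s x - a t x|%:E <= (3 * c)%:E)%E.
  by move=> c0; exact: L2unit_dist.
have b_series s t : (\sum_(j <oo) `|b s j - b t j|%:E <= \int[mu]_x `|a s x - a t x|%:E)%E.
  rewrite -sum_int//; apply: lee_nneseries => [j _ _|j _]; last exact: b_dist.
  by rewrite lee_fin.
exists b, p, (mulset L (invset V)); split; last first.
  move=> j s; apply/cvgrPdist_lt => c c0.
  have c40 : 0 < c / 4 by rewrite divr_gt0.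
  apply: filterS (etac s _ c40) => t st.
  rewrite -lte_fin distrC; apply: (@le_lt_trans _ _ (3 * (c / 4))%:E);
    last by rewrite lte_fin; lra.
  apply: le_trans (a_dist _ _ _ c40 st); apply: le_trans (b_series t s).
  apply: le_trans (nneseries_lim_ge j.+1 _); last by move=> i _ _; rewrite lee_fin.
  by rewrite big_nat_recr//= leeDr// sume_ge0// => i _; rewrite lee_fin.
split.
- by move=> s j; rewrite fine_ge0.
- move=> s; under eq_eseriesr do rewrite bE.
  by rewrite sum_int// a1.
- move=> s t Kst; apply: le_trans (b_series s t) _.
  have -> : e = 3 * (e / 3) by field.
  exact/a_dist/etaK.
- by apply: mulset_compact => //; apply: invset_compact; exact: unity_compact phiP.
- move=> s j; apply: contraNP => nL; apply/eqP.
  suff I00 : I j s = 0%E by rewrite /b I00.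
  rewrite -[RHS](integral0 mu setT); apply: ge0_ae_eq_integral => //.
  - exact/measurable_EFinP.
  - by move=> t _; rewrite lee_fin.
  have : {ae mu, forall x, ~ ((fun x : H => (s * x)%g) @` L) x -> eta s x = 0} := etaL s.
  apply: (@filterS _ _ (ae_filter_ringOfSetsType mu)) => t tL _ /=; congr EFin.
  have [->|pt] := eqVneq (phi j t) 0; first by rewrite mul0r.
  rewrite /a tL ?Normc.normc0 ?expr0n ?mulr0// => -[l Ll lt].
  apply: nL; exists l => //; exists ((p j)^-1 * t)^-1%g.
    by exists ((p j)^-1 * t)%g => //; exact: (unity_supp phiP pt).
  by rewrite -lt invgM invgK mulgA invgM mulgA mulgV mul1g.
Qed.

End reiter_of_property_A.

Lemma nat_pair_enum : exists e : nat -> nat * nat, forall p, exists n, e n = p.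
Proof.
exists (fun n => odflt (0%N, 0%N) (unpickle n : option (nat * nat))) => p.
by exists (pickle p); rewrite pickleK.
Qed.

Section exhaustion.
Variables (R : realType) (d : measure_display) (X : measurableType d).
Variables (mu : probability X R) (I : Type) (i0 : I).

(** The supremum of the measures of countable unions is attained, because
    countably many sequences can be merged into one; a member of the family that
    is not absorbed by the optimal union would enlarge it. *)
Lemma exhaustion (S : I -> set X) : (forall i, measurable (S i)) ->
  exists c : nat -> I, forall i, mu (S i `\` \bigcup_n S (c n)) = 0%E.
Proof.
move=> mS; pose U (c : nat -> I) := \bigcup_n S (c n).
have mU c : measurable (U c) by exact: bigcup_measurable.
pose E := [set fine (mu (U c)) | c in [set: nat -> I]].
have muE c : (fine (mu (U c)))%:E = mu (U c) by rewrite fineK// fin_num_measure.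
have Esup : has_sup E.
  split; first by exists (fine (mu (U (fun=> i0)))); exists (fun=> i0).
  by exists 1 => _ [c _ <-]; rewrite -lee_fin muE probability_le1.
have /choice[cs csP] : forall k : nat, exists c, sup E - k.+1%:R^-1 < fine (mu (U c)).
  move=> k; have k0 : 0 < k.+1%:R^-1 :> R by rewrite invr_gt0.
  by have [_ [c _ <-]] := sup_adherent k0 Esup; exists c.
have [e eK] := nat_pair_enum.
pose c n := cs (e n).1 (e n).2.
have subU k : U (cs k) `<=` U c.
  by move=> x [n _ Sx]; have [m em] := eK (k, n); exists m; rewrite // /c em.
have cmax : sup E <= fine (mu (U c)).
  apply/ler_addgt0Pr => r r0.
  have [k kr] : exists k : nat, k.+1%:R^-1 <= r.
    exists (Num.truncn r^-1); rewrite invf_ple ?posrE ?ltr0Sn//.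
    by rewrite ltW// truncnS_gt.
  apply: (@le_trans _ _ (fine (mu (U (cs k))) + k.+1%:R^-1)).
    by rewrite -lerBlDr ltW.
  by rewrite lerD// fine_le ?fin_num_measure// le_measure ?inE.
(* Prepending [i] to the sequence cannot increase the measure of the union. *)
exists c => i; pose c' n := if n is n'.+1 then c n' else i.
have Uc' : U c' = U c `|` (S i `\` U c).
  apply/seteqP; split=> [x [[|n] _ /= Sx]|x [[n _ Sx]|[Sx _]]].
  - by have [Ux|nUx] := pselect (U c x); [left|right].
  - by left; exists n.
  - by exists n.+1.
  - by exists 0%N.
have : (mu (U c') <= mu (U c))%E.
  rewrite -(muE c') -(muE c) lee_fin; apply: le_trans cmax; apply: sup_upper_bound => //.
  by exists c'.
have mD : measurable (S i `\` U c) by exact: measurableD.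
rewrite Uc' measureU//; last by rewrite setDE setIA setIC !setIA setICl !set0I.
rewrite -[leRHS]adde0 leeD2lE ?fin_num_measure// measure_le0.
by move=> /eqP.
Qed.

End exhaustion.

Section transfer.
Variables (R : realType) (G H : topologicalGroupType).
Variables (d : measure_display) (X : measurableType d) (mu : probability X R).
Variables (act : G -> X -> X) (omega : G -> X -> H) (F : set (set X)).
Hypothesis lcscH : lcsc H.
Hypothesis actP : nonsingular_action mu act.
Hypothesis omegaP : is_cocycle mu act omega.
Hypothesis Fmeas : F `<=` measurable.
Hypothesis omega_proper : proper_cocycle mu act omega F.
Hypothesis GX_A : pair_property_A mu act F.

(** The weights of [H] at [s_g(x)], multiplied by [q_g(x)^2], form densities on
    [X * nat] whose supports for [g] and [h] overlap only if [g] and [h] are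
    close.  Exhausting by the supports for countably many [c_n] and cutting along
    them transports the densities to the points [c_n] of [G]. *)
Lemma reiter_transfer :
  (forall (K : set H) (e : R), compact K -> 0 < e ->
    exists b r L, reiter K e b r L /\ forall j, continuous (fun s => b s j)) ->
  forall (K : set G) (e : R), compact K -> 0 < e ->
    exists w c L, reiter K e w c L.
Proof.
move=> HA K e cK e0.
(* Half of the error comes from [q_g], where L^1 distances are three times the
   L^2 ones, and half from the weights [b]. *)
have e60 : 0 < e / 6 by rewrite divr_gt0.
have e20 : 0 < e / 2 by rewrite divr_gt0.
have [q [s [[mq q0 q1 ms] [qK [L0 cL0 sL0] sC]]]] :=
  proper_cocycle_field lcscH actP omegaP Fmeas omega_proper GX_A cK
    (e := (e / 6) ^+ 2) ltac:(by rewrite exprn_gt0).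
have [b [r [L [bP bc]]]] := HA L0 (e / 2) cL0 e20.
have b0 := reiter_ge0 bP.
pose a g x := q g x ^+ 2.
have a0 g x : 0 <= a g x by exact: sqr_ge0.
have ma g : measurable_fun [set: X] (a g) by exact: measurable_funX.
have a1 g : (\int[mu]_x (a g x)%:E = 1)%E by exact: q1.
have aK g h : K (g^-1 * h)%g -> (\int[mu]_x `|a g x - a h x|%:E <= (e / 2)%:E)%E.
  move=> Kgh; have -> : e / 2 = 3 * (e / 6) by field.
  by apply: integral_dist_sqr => //; exact: qK.
pose beta g j x := a g x * b (s g x) j.
have beta0 g j x : 0 <= beta g j x by rewrite mulr_ge0.
have mbeta g j : measurable_fun [set: X] (beta g j).
  apply: measurable_funM => //.
  exact: (@borel_compR _ _ _ H (fun s => b s j) (s g) (bc j)).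
have sum_b (x : R) t : 0 <= x -> (\sum_(j <oo) (x * b t j)%:E = x%:E)%E.
  move=> x0; under eq_eseriesr do rewrite EFinM.
  by rewrite nneseriesZl ?(reiter_sum bP) ?mule1// => j _; rewrite lee_fin.
have sum_beta g x : (\sum_(j <oo) (beta g j x)%:E = (a g x)%:E)%E by exact: sum_b.
pose S j g := [set x | beta g j x != 0].
have mS j g : measurable (S j g).
  rewrite (_ : S j g = beta g j @^-1` (~` [set 0])).
    by rewrite -[X in measurable X]setTI; apply: mbeta => //; exact: measurableC.
  by apply/seteqP; split=> x /= /eqP.
have [c cP] : exists c : nat -> G, forall j g, mu (S j g `\` \bigcup_n S j (c n)) = 0%E.
  have /choice[cj cjP] := fun j => exhaustion mu (1%g : G) (mS j).
  have [en enP] := nat_pair_enum.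
  exists (fun n => cj (en n).1 (en n).2) => j g.
  apply/eqP; rewrite -measure_le0 -(cjP j g) le_measure ?inE//.
  - by apply: measurableD => //; exact: bigcup_measurable.
  - by apply: measurableD => //; exact: bigcup_measurable.
  - move=> x [Sx nU]; split=> // -[n _ Sn]; apply: nU.
    by have [m em] := enP (j, n); exists m; rewrite // em.
(* [P j n] is the part of the layer [j] that is transported to the point [c n]. *)
pose P j := seqDU (fun n => S j (c n)).
pose U j := \bigcup_n S j (c n).
have mP j n : measurable (P j n).
  by apply: measurableD => //; apply: bigsetU_measurable.
have sumP (f : nat -> X -> R) : (forall j, measurable_fun [set: X] (f j)) ->
    (forall j x, 0 <= f j x) ->
    (\sum_(n <oo) \sum_(j <oo) \int[mu]_(x in P j n) (f j x)%:E =
     \sum_(j <oo) \int[mu]_(x in U j) (f j x)%:E)%E.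
  move=> mf f0; rewrite nneseries_interchange; last first.
    by move=> n j; apply: integral_ge0 => x _; rewrite lee_fin.
  apply: eq_eseriesr => j _; rewrite /U (seqDU_bigcup_eq (fun n => S j (c n))).
  rewrite ge0_integral_bigcup//.
  - by move=> n; exact: mP.
  - by apply/measurable_EFinP; exact: measurable_funTS.
  - by move=> x _; rewrite lee_fin.
have sumX (f : nat -> X -> R) : (forall j, measurable_fun [set: X] (f j)) ->
    (forall j x, 0 <= f j x) ->
    (\sum_(j <oo) \int[mu]_x (f j x)%:E = \int[mu]_x \sum_(j <oo) (f j x)%:E)%E.
  move=> mf f0; rewrite integral_nneseries//.
  - by move=> j; exact/measurable_EFinP.
  - by move=> j x _; rewrite lee_fin.
pose W g n := (\sum_(j <oo) \int[mu]_(x in P j n) (beta g j x)%:E)%E.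
have I0 g j n : (0 <= \int[mu]_(x in P j n) (beta g j x)%:E)%E.
  by apply: integral_ge0 => x _; rewrite lee_fin.
have W0 g n : (0 <= W g n)%E by apply: nneseries_ge0 => j _ _; exact: I0.
have mU j : measurable (U j) by exact: bigcup_measurable.
have sumW g : (\sum_(n <oo) W g n = 1)%E.
  rewrite /W (sumP (beta g))// -(a1 g).
  rewrite [RHS](eq_integral (fun x => \sum_(j <oo) (beta g j x)%:E)%E); last first.
    by move=> x _; rewrite sum_beta.
  rewrite -sumX//; apply: eq_eseriesr => j _.
  rewrite integral_mkcond; apply: ge0_ae_eq_integral => //.
  - by apply/(measurable_restrictT _ _).1 => //; apply/measurable_EFinP;
      exact: measurable_funTS.
  - exact/measurable_EFinP.
  - by move=> x _; apply: erestrict_ge0 => y _; rewrite lee_fin.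
  - by move=> x _; rewrite lee_fin.
  - exists (S j g `\` U j); split; [exact: measurableD|exact: cP|].
    move=> x /= /not_implyP[_]; rewrite patchE; case: ifPn => // xU bx.
    split; last by move/mem_set; apply/negP.
    by apply/eqP => b00; apply: bx; rewrite b00.
have Wfin g n : W g n \is a fin_num.
  rewrite ge0_fin_numE//; apply: (@le_lt_trans _ _ 1%E); last exact: ltry.
  rewrite -(sumW g); apply: le_trans (nneseries_lim_ge n.+1 _) => //.
  by rewrite big_nat_recr//= leeDr//; apply: sume_ge0 => i _; exact: W0.
pose w g n := fine (W g n).
have wE g n : (w g n)%:E = W g n by rewrite fineK.
have mdist g h j : measurable_fun [set: X] (fun x => `|beta g j x - beta h j x|).
  by apply: measurableT_comp => //; exact: measurable_funB.
have W_le g h n : (W g n <= W h n +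
    \sum_(j <oo) \int[mu]_(x in P j n) `|beta g j x - beta h j x|%:E)%E.
  rewrite /W -nneseriesD//.
  - by apply: lee_nneseries => j _; [move=> _; exact: I0|exact: ge0_integral_leD].
  - by move=> j _ _; apply: integral_ge0 => x _; rewrite lee_fin.
have [C cC CP] := sC (mulset L (invset L))
  (mulset_compact (reiter_compact bP) (invset_compact (reiter_compact bP))).
exists w, c, C; split => //.
- by move=> g n; rewrite fine_ge0.
- by move=> g; under eq_eseriesr do rewrite wE; exact: sumW.
- move=> g h Kgh.
  apply: (@le_trans _ _ (\sum_(n <oo) \sum_(j <oo)
      \int[mu]_(x in P j n) `|beta g j x - beta h j x|%:E)%E).
    apply: lee_nneseries => [n _ _|n _]; first by rewrite lee_fin.
    apply: fine_dist_le => //; under eq_eseriesr do under eq_integral do rewrite distrC.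
    exact: W_le.
  rewrite (sumP (fun j x => `|beta g j x - beta h j x|))//.
  apply: (@le_trans _ _ (\sum_(j <oo) \int[mu]_x `|beta g j x - beta h j x|%:E)%E).
    apply: lee_nneseries => [j _ _|j _]; first by apply: integral_ge0 => x _;
      rewrite lee_fin.
    apply: ge0_subset_integral => //; exact/measurable_EFinP.
  rewrite (sumX (fun j x => `|beta g j x - beta h j x|))//.
  have mag : measurable_fun [set: X] (fun x => `|a g x - a h x|%:E).
    by apply/measurable_EFinP; apply: measurableT_comp => //; exact: measurable_funB.
  have mah : measurable_fun [set: X] (fun x => (a h x)%:E) by exact/measurable_EFinP.
  apply: (@le_trans _ _ (\int[mu]_x (`|a g x - a h x|%:E + (e / 2)%:E * (a h x)%:E))%E); last first.
    rewrite ge0_integralD//; first last.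
    - exact: measurable_funeM.
    - by move=> x _; rewrite mule_ge0 ?lee_fin// ltW.
    rewrite ge0_integralZl_EFin//; first last.
    - exact: ltW.
    - by move=> x _; rewrite lee_fin.
    by rewrite a1 mule1 [X in (_ <= X%:E)%E](splitr e) EFinD leeD2r// aK.
  apply: ae_ge0_le_integral => //.
  + by move=> x _; apply: nneseries_ge0 => j _ _; rewrite lee_fin.
  + apply: ge0_emeasurable_sum => [j x _ _|j _]; first by rewrite lee_fin.
    exact/measurable_EFinP.
  + by move=> x _; rewrite adde_ge0 ?mule_ge0 ?lee_fin// ltW.
  + by apply: emeasurable_funD => //; exact: measurable_funeM.
  (* If one of the two densities vanishes at [x], the sum over the layers of their
     differences is the other one; otherwise the weights [b] are close. *)
  + apply: filterS (sL0 g h Kgh) => x Lx _.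
    have [g0|g0] := eqVneq (q g x) 0.
      have ag0 : a g x = 0 by rewrite /a g0 expr0n.
      under eq_eseriesr => j _ do
        rewrite {1}/beta ag0 mul0r sub0r normrN (ger0_norm (beta0 h j x)).
      have ea0 : (0 <= (e / 2)%:E * (a h x)%:E)%E by rewrite mule_ge0// lee_fin// ltW.
      by rewrite sum_beta ag0 sub0r normrN (ger0_norm (a0 h x)) leeDl.
    have [h0|h0] := eqVneq (q h x) 0.
      have ah0 : a h x = 0 by rewrite /a h0 expr0n.
      under eq_eseriesr => j _ do
        rewrite {2}/beta ah0 mul0r subr0 (ger0_norm (beta0 g j x)).
      by rewrite sum_beta ah0 subr0 mule0 adde0 (ger0_norm (a0 g x)).
    have ag0 : 0 <= `|a g x - a h x| by [].
    apply: (@le_trans _ _ (\sum_(j <oo) ((`|a g x - a h x| * b (s g x) j)%:E +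
        (a h x)%:E * `|b (s g x) j - b (s h x) j|%:E))%E).
      apply: lee_nneseries => [j _ _|j _]; first by rewrite lee_fin.
      rewrite -EFinM -EFinD lee_fin.
      have -> : beta g j x - beta h j x = (a g x - a h x) * b (s g x) j +
          a h x * (b (s g x) j - b (s h x) j) by rewrite /beta; ring.
      apply: (le_trans (ler_normD _ _)).
      by rewrite (normrM (a g x - a h x)) (normrM (a h x)) (ger0_norm (b0 _ _)) (ger0_norm (a0 h x)).
    rewrite nneseriesD//; last first.
    - by move=> j _ _; rewrite mule_ge0 ?lee_fin.
    - by move=> j _ _; rewrite lee_fin mulr_ge0.
    rewrite sum_b// leeD2l// nneseriesZl => [|j _]; last by rewrite lee_fin.
    rewrite muleC lee_wpmul2r ?lee_fin//.
    by apply: (reiter_small bP); exact: Lx.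
(* A nonzero weight needs a layer [j] on which the supports for [g] and [c n]
   meet, and there [s_g] and [s_(c n)] are both close to [r j]. *)
- move=> g n; apply: contraNP => /CP nC; apply/eqP.
  suff W00 : W g n = 0%E by rewrite /w W00.
  apply: eseries0 => j _ _; rewrite integral_mkcond.
  rewrite -[RHS](integral0 mu setT); apply: ge0_ae_eq_integral => //.
  + by apply/(measurable_restrictT _ _).1 => //; apply/measurable_EFinP;
      exact: measurable_funTS.
  + by move=> x _; apply: erestrict_ge0 => y _; rewrite lee_fin.
  + apply: filterS nC => x nL _; rewrite patchE; case: ifPn => // /set_mem[Sx _].
    congr EFin; apply: contrapT => /eqP bgx.
    move: bgx Sx;
      rewrite /S/= /beta (mulf_eq0 (a g x)) (mulf_eq0 (a (c n) x)) !negb_or.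
    move=> /andP[ag bg] /andP[ac bcn].
    have qn g' : a g' x != 0 -> q g' x != 0 by apply: contra => /eqP; rewrite /a => ->;
      rewrite expr0n.
    apply: (nL (qn _ ag) (qn _ ac)).
    exists ((s g x)^-1 * r j)%g; first exact: (reiter_supp bP bg).
    exists ((s (c n) x)^-1 * r j)^-1%g.
      by exists ((s (c n) x)^-1 * r j)%g => //; exact: (reiter_supp bP bcn).
    by rewrite invgM invgK mulgA -(mulgA _ (r j)) mulgV mulg1.
Qed.

End transfer.

Section reiter_avg.
Variables (R : realType) (G : topologicalGroupType).

Lemma l1_dist_avg n (a : nat -> R) (w : nat -> nat -> R) (z : nat -> R) (e : R) :
  (forall i, 0 <= a i) -> \sum_(i < n) a i = 1 ->
  (forall i, a i != 0 -> (\sum_(j <oo) `|w i j - z j|%:E <= e%:E)%E) ->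
  (\sum_(j <oo) `|\sum_(i < n) a i * w i j - z j|%:E <= e%:E)%E.
Proof.
move=> a0 a1 wz.
apply: (@le_trans _ _ (\sum_(j <oo) \sum_(i < n) (a i)%:E * `|w i j - z j|%:E)%E).
  apply: lee_nneseries => [j _ _|j _]; first by rewrite lee_fin.
  rewrite sumEFin lee_fin.
  have -> : \sum_(i < n) a i * w i j - z j = \sum_(i < n) a i * (w i j - z j).
    under [RHS]eq_bigr do rewrite mulrBr.
    by rewrite sumrB -mulr_suml a1 mul1r.
  apply: (le_trans (ler_norm_sum _ _ _)); apply: ler_sum => i _.
  by rewrite normrM (ger0_norm (a0 i)).
rewrite nneseries_sum; last by move=> i j _; rewrite mule_ge0// lee_fin.
apply: (@le_trans _ _ (\sum_(i < n) (a i * e)%:E)%E).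
  apply: lee_sum => i _; rewrite nneseriesZl => [|j _]; last by rewrite lee_fin.
  have [->|ai] := eqVneq (a i) 0; first by rewrite mul0e mul0r.
  by rewrite EFinM lee_wpmul2l ?lee_fin//; exact: wz.
by rewrite sumEFin -mulr_suml a1 mul1r.
Qed.

(** Averaging the weights with a partition of unity makes them continuous in the
    l^1 norm.  At [g] and [h] it involves points [p_i] and [p_j] with
    [p_i^-1 p_j] in [V (g^-1 h) V^-1], which explains the enlarged tube. *)
Lemma reiter_avg (V K C : set G) (p : nat -> G) (phi : nat -> G -> R)
    (e : R) (w : G -> nat -> R) (c : nat -> G) :
  unity V p phi -> reiter (mulset (mulset V K) (invset V)) e w c C ->
  exists2 w' : G -> nat -> R, reiter K e w' c (mulset (invset V) C) &
    forall g (r : R), 0 < r -> \forall h \near g,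
      (\sum_(j <oo) `|w' h j - w' g j|%:E <= r%:E)%E.
Proof.
move=> phiP wP; have /choice[n nP] := unity_at phiP.
have phi0 := unity_ge0 phiP; have w0 := reiter_ge0 wP.
have cV := unity_compact phiP.
pose w' g j := \sum_(i < n g) phi i g * w (p i) j.
have w'E g m j : (forall i, (m <= i)%N -> phi i g = 0) ->
    w' g j = \sum_(i < m) phi i g * w (p i) j.
  move=> m0; have [_ n0] := nP g.
  by apply: (sum_ord_cutoff (f := fun i => phi i g * w (p i) j)) => i ?;
    [rewrite n0// mul0r|rewrite m0// mul0r].
exists w'; last first.
  move=> g r r0; have [m mP] := unity_near phiP g.
  have [_ m0] := nbhs_singleton mP.
  have : (fun h => \sum_(i < m) `|phi i h - phi i g|) @ g --> \sum_(i < m) `|phi i g - phi i g|.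
    apply: cvg_sumr => i; apply: cvg_norm; apply: cvgB; last exact: cvg_cst.
    exact: (unity_continuous phiP (i := i)).
  rewrite big1 => [|i _]; last by rewrite subrr normr0.
  move=> /cvgrPdist_le /(_ r r0) near_r; apply: filterS2 mP near_r => h [_ h0].
  rewrite sub0r normrN ger0_norm ?sumr_ge0// => hr.
  apply: (@le_trans _ _ (\sum_(j <oo) \sum_(i < m) `|phi i h - phi i g|%:E * (w (p i) j)%:E)%E).
    apply: lee_nneseries => [j _ _|j _]; first by rewrite lee_fin.
    rewrite sumEFin lee_fin (w'E h m j h0) (w'E g m j m0) -sumrB.
    apply: (le_trans (ler_norm_sum _ _ _)); apply: ler_sum => i _.
    by rewrite -mulrBl normrM (ger0_norm (w0 _ _)).
  rewrite nneseries_sum; last by move=> i j _; rewrite mule_ge0// lee_fin.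
  under eq_bigr => i _.
    rewrite nneseriesZl => [|j _]; last by rewrite lee_fin.
    rewrite (reiter_sum wP) mule1.
    over.
  by rewrite sumEFin lee_fin.
have avg_le g z (r : R) : (forall i, phi i g != 0 ->
    (\sum_(j <oo) `|w (p i) j - z j|%:E <= r%:E)%E) ->
    (\sum_(j <oo) `|w' g j - z j|%:E <= r%:E)%E.
  by have [n1 _] := nP g;
    apply: (l1_dist_avg (a := fun i => phi i g) (w := fun i => w (p i))).
have l1C (x y : nat -> R) : (\sum_(j <oo) `|x j - y j|%:E)%E = (\sum_(j <oo) `|y j - x j|%:E)%E.
  by apply: eq_eseriesr => j _; rewrite distrC.
split.
- by move=> g j; apply: sumr_ge0 => i _; rewrite mulr_ge0.
- move=> g; have [n1 _] := nP g.
  under eq_eseriesr do rewrite -sumEFin.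
  rewrite nneseries_sum; last by move=> i j _; rewrite lee_fin mulr_ge0.
  under eq_bigr => i _.
    under eq_eseriesr do rewrite EFinM.
    rewrite nneseriesZl => [|j _]; last by rewrite lee_fin.
    rewrite (reiter_sum wP) mule1.
    over.
  by rewrite sumEFin n1.
- move=> g h Kgh; apply: (avg_le) => i /(unity_supp phiP) Vi.
  rewrite l1C; apply: (avg_le) => j /(unity_supp phiP) Vj; rewrite l1C.
  apply: (reiter_small wP); exists ((p i)^-1 * g * (g^-1 * h))%g.
    by exists ((p i)^-1 * g)%g => //; exists (g^-1 * h)%g.
  exists ((p j)^-1 * h)^-1%g; first by exists ((p j)^-1 * h)%g.
  by rewrite invgM invgK -!mulgA mulVKg mulVKg.
- by apply: mulset_compact; [exact: invset_compact|exact: reiter_compact wP].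
- move=> g j w'g.
  have [i pi wi] : exists2 i, phi i g != 0 & w (p i) j != 0.
    apply: contrapT => /forall2NP H; move: w'g; rewrite /w' big1 ?eqxx// => i _.
    by apply/eqP; rewrite mulf_eq0; have [/negP/negPn ->|/negP/negPn ->] := H i;
      rewrite ?orbT.
  exists ((p i)^-1 * g)^-1%g; first by exists ((p i)^-1 * g)%g => //;
    exact: (unity_supp phiP pi).
  exists ((p i)^-1 * c j)%g; first exact: (reiter_supp wP wi).
  by rewrite invgM invgK -!mulgA mulVKg.
Qed.

Lemma sqrt_dist (x y : R) : 0 <= x -> 0 <= y ->
  (Num.sqrt x - Num.sqrt y) ^+ 2 <= `|x - y|.
Proof.
move=> x0 y0; rewrite -{2}(sqr_sqrtr x0) -{2}(sqr_sqrtr y0) subr_sqr normrM.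
rewrite -real_normK ?num_real// expr2 ler_wpM2l//.
rewrite [leRHS]ger0_norm ?addr_ge0 ?sqrtr_ge0//.
by apply: (le_trans (ler_normB _ _)); rewrite !ger0_norm ?sqrtr_ge0.
Qed.

(** Countably many translates of [V] cover the group, whose Haar measure does not
    vanish. *)
Lemma haar_compact_gt0 (mu : {measure set (borel G) -> \bar R}) (V : set G)
    (p : nat -> G) (phi : nat -> G -> R) : hausdorff_space G ->
  left_haar mu -> unity V p phi -> (0 < mu V)%E.
Proof.
move=> hG [inv _ muG] phiP; rewrite lt0e measure_ge0 andbT.
have mV : measurable (V : set (borel G)).
  by apply: borel_compact => //; exact: unity_compact phiP.
apply: contraL muG => /eqP V0; rewrite -leNgt.
have mpV i : measurable ([set (p i * v)%g | v in V] : set (borel G)).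
  by apply: borel_compact => //; apply: translate_compact; exact: (unity_compact phiP).
have -> : [set: G] = \bigcup_i ([set (p i * v)%g | v in V] : set (borel G)).
  apply/seteqP; split=> // g _; have [i Vi] := unity_cover phiP g; exists i => //.
  by exists ((p i)^-1 * g)%g => //; rewrite mulVKg.
apply: le_trans.
  apply: (@measure_sigma_subadditive _ _ _ mu _ (fun i => [set (p i * v)%g | v in V])) => //.
  exact: bigcupT_measurable.
by rewrite eseries0// => i _ _; rewrite inv.
Qed.

End reiter_avg.

Section property_A_of_reiter.
Variables (R : realType) (G : topologicalGroupType).
Variable mu : {measure set (borel G) -> \bar R}.
Hypothesis lcscG : lcsc G.
Hypothesis haar : left_haar mu.

(** Spreading the weight at [c_n] uniformly over the translate [c_n V] preserves
    total mass and does not increase l^1-distances; since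
    [(sqrt x - sqrt y)^2 <= |x - y|], the L^1-distance of two densities bounds the
    squared L^2-distance of their square roots. *)
Lemma property_A_of_reiter :
  (forall (K : set G) (e : R), compact K -> 0 < e -> exists w c L, reiter K e w c L) ->
  group_property_A mu.
Proof.
move=> GA K e cK e0; have [hG _ _] := lcscG.
have [V [p [phi phiP]]] := lcsc_unity R lcscG.
have cV := unity_compact phiP.
have e20 : 0 < e ^+ 2 / 2 by rewrite divr_gt0// exprn_gt0.
have [w0 [c [L0 wP0]]] := GA _ _ (mulset_compact (mulset_compact cV cK) (invset_compact cV)) e20.
have {w0 wP0} [w wP wc] := reiter_avg phiP wP0.
set L := mulset _ L0 in wP.
have w0 := reiter_ge0 wP.
have [inv fin _] := haar.
have muV0 := haar_compact_gt0 hG haar phiP.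
have muVfin : mu V \is a fin_num by rewrite ge0_fin_numE//; exact: fin.
pose m := fine (mu V).
have mE : m%:E = mu V by rewrite fineK.
have m0 : 0 < m by rewrite -lte_fin mE.
pose T n : set (borel G) := [set (c n * v)%g | v in V].
have mT n : measurable (T n).
  by apply: borel_compact => //; exact: translate_compact.
have muT n : mu (T n) = m%:E.
  by rewrite mE inv//; exact: borel_compact.
(* The density of the weight [x] spread uniformly over the translate [T n]. *)
pose u (x : R) n (s : borel G) := x * (m^-1 * \1_(T n) s).
have i0 n (s : borel G) : 0 <= m^-1 * \1_(T n) s :> R.
  by rewrite mulr_ge0 ?invr_ge0 ?(ltW m0)// indicE.
have u0 x n s : 0 <= x -> 0 <= u x n s by move=> x0; rewrite mulr_ge0.
have mu_u x n : measurable_fun [set: borel G] (u x n).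
  by do 2 apply: measurable_funM => //; exact: measurable_indic.
have int_u x n : 0 <= x -> (\int[mu]_s (u x n s)%:E = x%:E)%E.
  move=> x0; under eq_integral do rewrite EFinM EFinM.
  rewrite ge0_integralZl_EFin//; first last.
  - by apply: measurable_funeM; apply/measurable_EFinP; exact: measurable_indic.
  - by move=> s _; rewrite -EFinM lee_fin.
  rewrite ge0_integralZl_EFin//; first last.
  - by rewrite invr_ge0 ltW.
  - by apply/measurable_EFinP; exact: measurable_indic.
  by rewrite integral_indic// setIT muT -EFinM mulVf; [rewrite mulr1|rewrite (gt_eqF m0)].
have int_series (x : nat -> R) : (forall n, 0 <= x n) ->
    (\int[mu]_s \sum_(n <oo) (u (x n) n s)%:E = \sum_(n <oo) (x n)%:E)%E.
  move=> x0; rewrite integral_nneseries//.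
  - by apply: eq_eseriesr => n _; rewrite int_u.
  - by move=> n; exact/measurable_EFinP.
  - by move=> n s _; rewrite lee_fin u0.
pose f g s := (\sum_(n <oo) (u (w g n) n s)%:E)%E.
have f0 g s : (0 <= f g s)%E by apply: nneseries_ge0 => n _ _; rewrite lee_fin u0.
have ffin g s : f g s \is a fin_num.
  rewrite ge0_fin_numE//; apply: (@le_lt_trans _ _ (m^-1)%:E); last exact: ltry.
  apply: (@le_trans _ _ (\sum_(n <oo) (m^-1%:E * (w g n)%:E))%E).
    apply: lee_nneseries => [n _ _|n _]; first by rewrite lee_fin u0.
    rewrite -EFinM lee_fin /u mulrC ler_wpM2r// ler_piMr ?invr_ge0 ?(ltW m0)//.
  by rewrite nneseriesZl ?(reiter_sum wP) ?mule1// => n _; rewrite lee_fin.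
pose D g s := fine (f g s).
have DE g s : (D g s)%:E = f g s by rewrite fineK.
have D0 g s : 0 <= D g s by exact: fine_ge0.
have mD g : measurable_fun [set: borel G] (D g).
  apply: measurableT_comp => //.
  apply: ge0_emeasurable_sum => [n s _ _|n _]; first by rewrite lee_fin u0.
  exact/measurable_EFinP.
have D1 g : (\int[mu]_s (D g s)%:E = 1)%E.
  under eq_integral do rewrite DE.
  by rewrite int_series// (reiter_sum wP).
have D_dist g h : (\int[mu]_s `|D g s - D h s|%:E <= \sum_(n <oo) `|w g n - w h n|%:E)%E.
  rewrite -int_series//; apply: ge0_le_integral => //.
  - by apply/measurable_EFinP; apply: measurableT_comp => //; exact: measurable_funB.
  - apply: ge0_emeasurable_sum => [n s _ _|n _]; first by rewrite lee_fin u0.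
    exact/measurable_EFinP.
  move=> s _;
    have f_le g1 g2 : (f g1 s <= f g2 s + \sum_(n <oo) (u `|w g1 n - w g2 n| n s)%:E)%E.
    rewrite -nneseriesD; last 2 first.
    - by move=> n _ _; rewrite lee_fin u0.
    - by move=> n _ _; rewrite lee_fin u0.
    apply: lee_nneseries => [n _ _|n _]; first by rewrite lee_fin u0.
    rewrite -EFinD lee_fin /u -mulrDl ler_wpM2r//.
    by rewrite -lerBlDl; exact: ler_norm.
  apply: fine_dist_le => //.
  by under eq_eseriesr do rewrite distrC; exact: f_le.
pose xi g (s : borel G) : R[i] := (Num.sqrt (D g s))%:C%C.
have mxi g : cmeasurable (xi g).
  by split; [exact: measurable_sqrt|exact: measurable_cst].
have normc_real (x : R) : Normc.normc x%:C%C ^+ 2 = x ^+ 2.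
  by rewrite /= expr0n/= addr0 sqrtr_sqr real_normK ?num_real.
have xi_dist g h : (sq_integral mu (xi g \- xi h)%R <= \sum_(n <oo) `|w g n - w h n|%:E)%E.
  apply: le_trans (D_dist g h); apply: ge0_le_integral => //.
  - by move=> s _; rewrite lee_fin sqr_ge0.
  - by apply/measurable_EFinP/measurable_funX/cmeasurable_normc/cmeasurableB.
  - by apply/measurable_EFinP; apply: measurableT_comp => //; exact: measurable_funB.
  - move=> s _; rewrite lee_fin.
    have -> : (xi g \- xi h)%R s = (Num.sqrt (D g s) - Num.sqrt (D h s))%:C%C.
      by rewrite rmorphB.
    by rewrite normc_real; exact: sqrt_dist.
exists xi; split.
- move=> g; split => //; apply/L2norm1.
  rewrite /sq_integral -(D1 g); apply: eq_integral => s _.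
  by rewrite normc_real sqr_sqrtr.
- move=> g r r0; have r20 : 0 < r ^+ 2 / 2 by rewrite divr_gt0// exprn_gt0.
  apply: filterS (wc g _ r20) => h wh; apply/(L2norm_lt _ _ r0).
  apply: le_lt_trans (xi_dist h g) _; apply: le_lt_trans wh _.
  by rewrite lte_fin ltr_pdivrMr// ltr_pMr ?exprn_gt0// ltr1n.
- move=> g h Kgh; apply/(L2norm_lt _ _ e0).
  apply: le_lt_trans (xi_dist g h) _; apply: le_lt_trans (reiter_small wP Kgh) _.
  by rewrite lte_fin ltr_pdivrMr// ltr_pMr ?exprn_gt0// ltr1n.
- exists (mulset L V); first by apply: mulset_compact => //; exact: reiter_compact wP.
  move=> g; apply: aeW => s nLV.
  suff fs0 : f g s = 0%E by rewrite /xi /D fs0/= sqrtr0.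
  apply: eseries0 => n _ _; congr EFin; rewrite /u.
  have [->|wgn] := eqVneq (w g n) 0; first by rewrite mul0r.
  rewrite indicE; case: (boolP (s \in T n)) => [/set_mem[v Vv cvs]|_];
    last by rewrite !mulr0.
  exfalso; apply: nLV; exists (g^-1 * s)%g; last by rewrite mulVKg.
  exists (g^-1 * c n)%g; first exact: (reiter_supp wP wgn).
  by exists v => //; rewrite -mulgA cvs.
Qed.

End property_A_of_reiter.

(** * The permanence theorem *)

Theorem theorem0p7 (R : realType) (G H : topologicalGroupType)
    (d : measure_display) (X : measurableType d) (mu : probability X R)
    (act : G -> X -> X) (omega : G -> X -> H) (F : set (set X))
    (lcscG : lcsc G) (lcscH : lcsc H)
    (stdX : standard_borel R X)
    (actP : nonsingular_action mu act)
    (omegaP : is_cocycle mu act omega)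
    (Fmeas : F `<=` measurable)
    (omega_proper : proper_cocycle mu act omega F)
    (GX_A : pair_property_A mu act F) :
  (forall (muG : {measure set (borel G) -> \bar R})
          (muH : {measure set (borel H) -> \bar R}),
      left_haar muG -> left_haar muH ->
      group_property_A muH -> group_property_A muG) /\
  (coarsely_embeddable R H -> coarsely_embeddable R G).
Proof.
split=> [muG muH haarG _ HA|].
  apply: (property_A_of_reiter lcscG haarG).
  apply: (reiter_transfer lcscH actP omegaP Fmeas omega_proper GX_A).
  by move=> K e cK e0; exact: (reiter_of_property_A lcscH HA cK e0).
exact: (coarsely_embeddable_of_cocycle lcscG lcscH actP omegaP Fmeas omega_proper GX_A).
Qed.
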